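(* The Hopf algebra $\mathcal O_\epsilon^\varphi(G)_{\mathbb Q(\epsilon)}$ is a $2$-cocycle deformation of $\mathcal O_\epsilon(G)_{\mathbb Q(\epsilon)}$.
   Context: **Setting.** $G$ is a connected, simply connected simple complex algebraic group, $\mathfrak g=\mathrm{Lie}(G)$, $\Pi=\{\alpha_1,\dots,\alpha_n\}$ simple roots, $(a_{ij})$ the Cartan matrix, $(\cdot,\cdot)$ the usual normalized form with $(\alpha_i,\alpha_j)=d_ia_{ij}$; $\omega_i$ fundamental weights, $(\omega_i,\alpha_j)=d_i\delta_{ij}$; $P=\bigoplus\mathbb Z\omega_i$, $Q=\bigoplus\mathbb Z\alpha_i$. $q$ indeterminate, $q_i=q^{d_i}$, $R=\mathbb Q[q,q^{-1}]$; $\epsilon$ a primitive $\ell$-th root of unity, $\ell$ odd, $3\nmid\ell$ in type $G_2$; $R/\chi_\ell(q)R=\mathbb Q(\epsilon)$. Twisting map: $\varphi:\mathbb QP\to\mathbb QP$ is $\mathbb Q$-linear, $(\varphi x,y)=-(x,\varphi y)$, $\varphi\alpha_i=2\tau_i$ with $\tau_i\in P$ and $\tau_i=\sum_jy_{ji}\alpha_j$, $y_{ji}\in\mathbb Z$, and $\frac12(\varphi\lambda,\mu)\in\mathbb Z$ for $\lambda,\mu\in P$. **Algebras.** $U_q^\varphi(\mathfrak g)$: the usual quantized enveloping algebra over $\mathbb Q(q)$ with generators $E_i,F_i,K_\lambda$ ($\lambda\in Q$), relations $K_\lambda E_jK_{-\lambda}=q^{(\lambda,\alpha_j)}E_j$,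 $K_\lambda F_jK_{-\lambda}=q^{-(\lambda,\alpha_j)}F_j$, $[E_i,F_j]=\delta_{ij}\frac{K_{\alpha_i}-K_{\alpha_i}^{-1}}{q_i-q_i^{-1}}$, quantum Serre, and Hopf structure $\Delta_\varphi(E_i)=E_i\otimes K_{\tau_i}+K_{\alpha_i-\tau_i}\otimes E_i$, $\Delta_\varphi(F_i)=F_i\otimes K_{-\alpha_i-\tau_i}+K_{\tau_i}\otimes F_i$, $K_\lambda$ group-like. $\Gamma^\varphi(\mathfrak g)$: the $R$-Hopf subalgebra generated by $K_{\alpha_i}^{-1}$, $\binom{K_{\alpha_i};0}{t}=\prod_{s=1}^t\frac{K_{\alpha_i}q_i^{-s+1}-1}{q_i^s-1}$, $E_i^{(t)}=E_i^t/[t]_{q_i}!$, $F_i^{(t)}=F_i^t/[t]_{q_i}!$ ($t\ge1$). $R_q^\varphi[G]\subseteq\mathrm{Hom}_R(\Gamma^\varphi(\mathfrak g),R)$: the $R$-Hopf algebra spanned by matrix coefficients of $\Gamma^\varphi(\mathfrak g)$-modules free of finite rank over $R$ on which $K_{\alpha_i}$, $\binom{K_{\alpha_i};0}{t}$ are diagonal with eigenvalues $q_i^m$, $\binom mt_{q_i}$ (Gaussian binomials). $\mathcal O_\epsilon^\varphi(G)_{\mathbb Q(\epsilon)}=R_q^\varphi[G]\otimes_R\mathbb Q(\epsilon)$. The superscript is omitted when $\varphi=0$. **Cocycle deformation.** A convolution-invertible linear map $\sigma:H\otimes H\to\Bbbk$ is a normalized multiplicative $2$-cocycle on a Hopf algebra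 $H$ if $\sigma(b_{(1)},c_{(1)})\sigma(a,b_{(2)}c_{(2)})=\sigma(a_{(1)},b_{(1)})\sigma(a_{(2)}b_{(2)},c)$ and $\sigma(a,1)=\varepsilon(a)=\sigma(1,a)$. Then $H_\sigma$ is the Hopf algebra with the coalgebra structure of $H$ and product $a\cdot_\sigma b=\sigma(a_{(1)},b_{(1)})a_{(2)}b_{(2)}\sigma^{-1}(a_{(3)},b_{(3)})$. A Hopf algebra is a $2$-cocycle deformation of $H$ if it is isomorphic to $H_\sigma$ for some such $\sigma$. *)

(* Defs.v *)
From HB Require Import structures.
From mathcomp Require Import all_boot all_order all_algebra all_field.
From mathcomp Require Import sesquilinear boolp.

Set Implicit Arguments.
Unset Strict Implicit.
Unset Printing Implicit Defensive.

Import Order.TTheory GRing.Theory Num.Theory.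
Local Open Scope ring_scope.

(** An element of V (x)_k W is given by a finite family of pure tensors.  By
    the universal property of V (x)_k W, two families have the same sum in
    V (x)_k W iff every k-bilinear map takes the same value on both. *)

Definition teq (k : comNzRingType) (V W : lmodType k) (s t : seq (V * W)) :
    Prop :=
  forall (M : lmodType k) (b : {bilinear V -> W -> M}),
    \sum_(p <- s) b p.1 p.2 = \sum_(p <- t) b p.1 p.2.

Definition trilinear (k : comNzRingType) (V1 V2 V3 M : lmodType k)
    (f : V1 -> V2 -> V3 -> M) : Prop :=
  [/\ forall y z, linear (fun x => f x y z),
      forall x z, linear (fun y => f x y z) &
      forall x y, linear (fun z => f x y z)].

Definition teq3 (k : comNzRingType) (V1 V2 V3 : lmodType k)
    (s t : seq (V1 * V2 * V3)) : Prop :=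
  forall (M : lmodType k) (f : V1 -> V2 -> V3 -> M), trilinear f ->
    \sum_(p <- s) f p.1.1 p.1.2 p.2 = \sum_(p <- t) f p.1.1 p.1.2 p.2.

(** [cop a] is a family representing the coproduct of [a], i.e. the summands
    [(a_(1), a_(2))] of Sweedler's notation; only its class modulo [teq] is
    meaningful. *)

Record hopf_axioms (k : comNzRingType) (H : algType k)
    (cop : H -> seq (H * H)) (counit : {lrmorphism H -> k | *%R})
    (antipode : {linear H -> H}) : Prop := {
  cop_linear : forall (c : k) (a b : H),
    teq (cop (c *: a + b)) ([seq (c *: p.1, p.2) | p <- cop a] ++ cop b);
  cop_one : teq (cop 1) [:: (1, 1)];
  cop_mul : forall a b : H,
    teq (cop (a * b)) [seq (x.1 * y.1, x.2 * y.2) | x <- cop a, y <- cop b];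
  cop_coassoc : forall a : H,
    teq3 [seq (y.1, y.2, x.2) | x <- cop a, y <- cop x.1]
         [seq (x.1, y.1, y.2) | x <- cop a, y <- cop x.2];
  counit_left : forall a : H, \sum_(x <- cop a) counit x.1 *: x.2 = a;
  counit_right : forall a : H, \sum_(x <- cop a) counit x.2 *: x.1 = a;
  antipode_left : forall a : H,
    \sum_(x <- cop a) antipode x.1 * x.2 = (counit a)%:A;
  antipode_right : forall a : H,
    \sum_(x <- cop a) x.1 * antipode x.2 = (counit a)%:A
}.

Record hopf (k : comNzRingType) := Hopf {
  hopf_alg :> algType k;
  cop : hopf_alg -> seq (hopf_alg * hopf_alg);
  counit : {lrmorphism hopf_alg -> k | *%R};
  antipode : {linear hopf_alg -> hopf_alg};
  hopfP : hopf_axioms cop counit antipode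
}.

Arguments cop {k h} : rename.
Arguments counit {k h} : rename.
Arguments antipode {k h} : rename.

Definition cop3 (k : comNzRingType) (H : hopf k) (a : H) : seq (H * H * H) :=
  [seq (y.1, y.2, x.2) | x <- cop a, y <- cop x.1].

Section Cocycles.
Variables (k : comNzRingType) (H : hopf k).
Implicit Types s t : {biscalar H}.

Definition conv_inverse s t : Prop := forall a b : H,
  \sum_(x <- cop a) \sum_(y <- cop b) s x.1 y.1 * t x.2 y.2
    = counit a * counit b /\
  \sum_(x <- cop a) \sum_(y <- cop b) t x.1 y.1 * s x.2 y.2
    = counit a * counit b.

Definition normalized_2cocycle s : Prop :=
  (forall a b c : H,
     \sum_(y <- cop b) \sum_(z <- cop c) s y.1 z.1 * s a (y.2 * z.2) =
     \sum_(x <- cop a) \sum_(y <- cop b) s x.1 y.1 * s (x.2 * y.2) c) /\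
  (forall a : H, s a 1 = counit a /\ s 1 a = counit a).

(* The product of H_s, where t is the convolution inverse of s. *)
Definition cocycle_mul s t (a b : H) : H :=
  \sum_(x <- cop3 a) \sum_(y <- cop3 b)
    (s x.1.1 y.1.1 * t x.2 y.2) *: (x.1.2 * y.1.2).

(* [f : L -> H_s] is an isomorphism of Hopf algebras.  H_s has the unit and the
   coalgebra structure of H; a bijective bialgebra map automatically commutes
   with the antipodes. *)
Definition hopf_iso_deformed (L : hopf k) s t (f : {linear L -> H}) : Prop :=
  [/\ bijective f, f 1 = 1,
      forall a b : L, f (a * b) = cocycle_mul s t (f a) (f b),
      forall a : L, teq (cop (f a)) [seq (f x.1, f x.2) | x <- cop a] &
      forall a : L, counit (f a) = counit a].

End Cocycles.

Definition is_2cocycle_deformation (k : comNzRingType) (L H : hopf k) : Prop :=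
  exists (s t : {biscalar H}) (f : {linear L -> H}),
    [/\ conv_inverse s t, normalized_2cocycle s & hopf_iso_deformed s t f].

Notation Qq := {fraction {poly rat}}.
Definition qv : Qq := tofrac 'X.

(* R = Q[q, q^-1], as a subring of Q(q). *)
Definition laurent_pred : {pred Qq} :=
  fun x => `[< exists (n : nat) (p : {poly rat}), x * qv ^+ n = tofrac p >].

Lemma laurent_subring : subring_closed laurent_pred.
Proof.
split=> [|x y /asboolP[n [p xE]] /asboolP[m [r yE]]
         |x y /asboolP[n [p xE]] /asboolP[m [r yE]]]; apply/asboolP.
- by exists 0%N, 1; rewrite expr0 mulr1 tofrac1.
- exists (n + m)%N, (p * 'X^m - r * 'X^n).
  rewrite tofracB !tofracM !tofracXn -/qv -xE -yE exprD mulrBl -!mulrA.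
  by rewrite (mulrC (qv ^+ n) (qv ^+ m)).
- exists (n + m)%N, (p * r).
  by rewrite tofracM -xE -yE exprD mulrACA.
Qed.

HB.instance Definition _ :=
  GRing.isSubringClosed.Build Qq laurent_pred laurent_subring.

Record laurent := Laurent { lval : Qq; lvalP : lval \in laurent_pred }.

HB.instance Definition _ := [isSub for lval].
HB.instance Definition _ := [Choice of laurent by <:].
HB.instance Definition _ := [SubChoice_isSubComNzRing of laurent by <:].

Lemma qv_laurent : qv \in laurent_pred.
Proof. by apply/asboolP; exists 0%N, 'X; rewrite expr0 mulr1. Qed.

Definition ql : laurent := Laurent qv_laurent.

(** Square-bracket integers are the symmetric ones; round-bracket Gaussian
    binomials are the ones for which K_{alpha_i} = q_i^m forces
    binom(K_{alpha_i}; 0 | t) = [gbinom q_i m t]. *)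

Definition qint (v : Qq) (m : nat) : Qq := (v ^+ m - v ^- m) / (v - v^-1).
Definition qfact (v : Qq) (m : nat) : Qq := \prod_(1 <= s < m.+1) qint v s.
Definition qbinom (v : Qq) (m t : nat) : Qq :=
  qfact v m / (qfact v t * qfact v (m - t)).
Definition gbinom (v : Qq) (m : int) (t : nat) : Qq :=
  \prod_(1 <= s < t.+1) ((v ^ (m - s%:Z + 1) - 1) / (v ^+ s - 1)).

(** A connected simply connected simple complex group G enters only through
    its Cartan matrix: an indecomposable Cartan matrix of finite type, together
    with the coprime symmetrizing integers d_i. *)

Record cartan_datum := CartanDatum {
  rk : nat;
  cartan : 'M[int]_rk;
  dd : 'I_rk -> nat;
  cartan_diag : forall i, cartan i i = 2;
  cartan_offdiag : forall i j, i != j -> cartan i j <= 0;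
  dd_gt0 : forall i, (0 < dd i)%N;
  cartan_sym : forall i j, (dd i)%:Z * cartan i j = (dd j)%:Z * cartan j i;
  dd_normalized : exists i, dd i = 1%N;
  cartan_posdef : forall x : 'rV[rat]_rk, x != 0 ->
    0 < \sum_i \sum_j x 0 i * x 0 j * ((dd i)%:Z * cartan i j)%:~R;
  cartan_indecomposable : forall J : {set 'I_rk}, J != set0 -> J != setT ->
    exists i j, [/\ i \in J, j \notin J & cartan i j != 0]
}.

Definition type_G2 (C : cartan_datum) : Prop :=
  rk C = 2%N /\ exists i j, cartan C i j = -1 /\ cartan C j i = -3.

Section RootData.
Variable C : cartan_datum.
Local Notation n := (rk C).

(* Elements of Q and of QP are given by their coordinates on the simple
   roots. *)
Definition rootQ := 'rV[int]_n.
Definition spaceQ := 'rV[rat]_n.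
Definition qroot (l : rootQ) : spaceQ := map_mx intr l.

Definition alpha (i : 'I_n) : rootQ := delta_mx 0 i.

Definition gram : 'M[int]_n := \matrix_(i, j) ((dd i)%:Z * cartan C i j).
Definition gramQ : 'M[rat]_n := map_mx intr gram.

Definition pairQ (l m : rootQ) : int := (l *m gram *m m^T) 0 0.
Definition pair (x y : spaceQ) : rat := (x *m gramQ *m y^T) 0 0.

(* The vector with (omega i, alpha j) = d_i delta_ij. *)
Definition omega (i : 'I_n) : spaceQ := (dd i)%:R *: row i (invmx gramQ).

Definition weight (x : spaceQ) : Prop :=
  exists c : 'I_n -> int, x = \sum_i (c i)%:~R *: omega i.

Record twisting := Twisting {
  phi : {linear spaceQ -> spaceQ};
  tau : 'I_n -> rootQ;
  phi_antisym : forall x y, pair (phi x) y = - pair x (phi y);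
  phi_alpha : forall i, phi (qroot (alpha i)) = 2 *: qroot (tau i);
  tau_weight : forall i, weight (qroot (tau i));
  phi_half_int : forall x y, weight x -> weight y ->
    exists z : int, 2^-1 * pair (phi x) y = z%:~R
}.

Lemma weight0 : weight 0.
Proof. by exists (fun=> 0); rewrite big1 // => i _; rewrite scale0r. Qed.

Definition no_twist : twisting.
Proof.
refine (@Twisting (\0 : {linear spaceQ -> spaceQ}) (fun=> 0) _ _ _ _).
- move=> x y; rewrite /pair /= mul0mx mul0mx.
  have -> : ((\0%R : spaceQ -> spaceQ) y)^T = 0 by rewrite trmx0.
  by rewrite mulmx0 mxE oppr0.
- by move=> i; rewrite /qroot map_mx0 scaler0.
- by move=> i; rewrite /qroot map_mx0; exact: weight0.
- by move=> x y _ _; exists 0; rewrite /pair /= !mul0mx mxE mulr0.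
Defined.

Definition qi (i : 'I_n) : Qq := qv ^+ dd i.

Record Uq_relations (A : algType Qq) (E F : 'I_n -> A) (K : rootQ -> A) :
    Prop := {
  K_zero : K 0 = 1;
  K_add : forall l m, K (l + m) = K l * K m;
  K_E : forall l j, K l * E j * K (- l) = qv ^ (pairQ l (alpha j)) *: E j;
  K_F : forall l j, K l * F j * K (- l) = qv ^ (- pairQ l (alpha j)) *: F j;
  E_F : forall i j, E i * F j - F j * E i =
    if i == j then (qi i - (qi i)^-1)^-1 *: (K (alpha i) - K (- alpha i))
    else 0;
  E_serre : forall i j, i != j -> let m := absz (1 - cartan C i j) in
    \sum_(s < m.+1)
      ((-1) ^+ s * qbinom (qi i) m s) *: (E i ^+ (m - s) * E j * E i ^+ s) = 0;
  F_serre : forall i j, i != j -> let m := absz (1 - cartan C i j) in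
    \sum_(s < m.+1)
      ((-1) ^+ s * qbinom (qi i) m s) *: (F i ^+ (m - s) * F j * F i ^+ s) = 0
}.

Definition preserves_generators (A B : algType Qq) (g : A -> B)
    (E F : 'I_n -> A) (K : rootQ -> A) (E' F' : 'I_n -> B) (K' : rootQ -> B) :
    Prop :=
  [/\ forall i, g (E i) = E' i, forall i, g (F i) = F' i &
      forall l, g (K l) = K' l].

(* U_q(g) is specified by its presentation and its coproduct on generators;
   this determines the Hopf algebra, counit and antipode included, up to a
   unique isomorphism.  The later specifications [is_Gamma], [is_Rq] and
   [is_base_change] likewise determine their objects up to isomorphism. *)
Record is_Uq (tw : twisting) (U : hopf Qq) (E F : 'I_n -> U) (K : rootQ -> U) :
    Prop := {
  Uq_rel : Uq_relations E F K;
  Uq_univ : forall (B : algType Qq) (E' F' : 'I_n -> B) (K' : rootQ -> B),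
    Uq_relations E' F' K' ->
    exists2 g : {lrmorphism U -> B}, preserves_generators g E F K E' F' K' &
      forall h : {lrmorphism U -> B},
        preserves_generators h E F K E' F' K' -> h =1 g;
  Uq_copE : forall i,
    teq (cop (E i)) [:: (E i, K (tau tw i)); (K (alpha i - tau tw i), E i)];
  Uq_copF : forall i,
    teq (cop (F i)) [:: (F i, K (- alpha i - tau tw i)); (K (tau tw i), F i)];
  Uq_copK : forall l, teq (cop (K l)) [:: (K l, K l)]
}.

Section Gamma.
Variables (U : hopf Qq) (E F : 'I_n -> U) (K : rootQ -> U).

Definition divided_power (v : Qq) (x : U) (t : nat) : U :=
  (qfact v t)^-1 *: x ^+ t.

Definition K_binom (i : 'I_n) (t : nat) : U :=
  \prod_(1 <= s < t.+1)
    ((qi i ^+ s - 1)^-1 *: (qi i ^ (1 - s%:Z) *: K (alpha i) - 1)).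

Inductive in_Gamma : U -> Prop :=
| Gamma_Kinv i : in_Gamma (K (- alpha i))
| Gamma_Kbinom i t : (0 < t)%N -> in_Gamma (K_binom i t)
| Gamma_E i t : (0 < t)%N -> in_Gamma (divided_power (qi i) (E i) t)
| Gamma_F i t : (0 < t)%N -> in_Gamma (divided_power (qi i) (F i) t)
| Gamma_one : in_Gamma 1
| Gamma_scale (r : laurent) x : in_Gamma x -> in_Gamma (val r *: x)
| Gamma_add x y : in_Gamma x -> in_Gamma y -> in_Gamma (x + y)
| Gamma_mul x y : in_Gamma x -> in_Gamma y -> in_Gamma (x * y).

(* G is the R-algebra Gamma, included in U by incl, as an R-Hopf subalgebra. *)
Record is_Gamma (G : hopf laurent) (incl : {rmorphism G -> U}) : Prop := {
  incl_inj : injective incl;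
  incl_scale : forall (r : laurent) (x : G), incl (r *: x) = val r *: incl x;
  incl_image : forall u : U, in_Gamma u <-> exists x : G, incl x = u;
  incl_cop : forall x : G,
    teq (cop (incl x)) [seq (incl y.1, incl y.2) | y <- cop x];
  incl_counit : forall x : G, counit (incl x) = val (counit x);
  incl_antipode : forall x : G, antipode (incl x) = incl (antipode x)
}.

Variables (G : hopf laurent) (incl : G -> U).

(* A G-module structure on the free R-module of column vectors of height N, in
   whose standard basis K_{alpha_i} and binom(K_{alpha_i}; 0 | t) are
   diagonal; m i a is the exponent of the i-th eigenvalue on the a-th basis
   vector. *)
Definition admissible (N : nat) (rho : {linear G -> 'M[laurent]_N}) : Prop :=
  [/\ rho 1 = 1%:M,
      forall x y : G, rho (x * y) = rho x *m rho y &
      exists m : 'I_n -> 'I_N -> int,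
        (forall i (x : G), incl x = K (alpha i) ->
           forall a b : 'I_N,
             val (rho x a b) = if a == b then qi i ^ m i b else 0) /\
        (forall i t (x : G), incl x = K_binom i t ->
           forall a b : 'I_N,
             val (rho x a b) = if a == b then gbinom (qi i) (m i b) t else 0)].

Definition matrix_coefficient (f : G -> laurent) : Prop :=
  exists (N : nat) (rho : {linear G -> 'M[laurent]_N}),
    admissible rho /\
    exists (u : 'rV[laurent]_N) (v : 'cV[laurent]_N),
      forall x : G, f x = (u *m rho x *m v) 0 0.

Definition matrix_coefficient_span (f : G -> laurent) : Prop :=
  exists (N : nat) (r : 'I_N -> laurent) (g : 'I_N -> G -> laurent),
    (forall i, matrix_coefficient (g i)) /\
    forall x : G, f x = \sum_i r i * g i x.

(* A is R_q[G]: [ev a] is the element a of Hom_R(Gamma, R), and the Hopf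
   structure is dual to that of Gamma. *)
Record is_Rq (A : hopf laurent) (ev : A -> G -> laurent) : Prop := {
  ev_linear_l : forall x : G, linear_for *%R (fun a : A => ev a x);
  ev_linear_r : forall a : A, linear_for *%R (ev a);
  ev_inj : forall a b : A, ev a =1 ev b -> a = b;
  ev_image : forall f : G -> laurent,
    matrix_coefficient_span f <-> exists a : A, ev a =1 f;
  ev_one : forall x : G, ev 1 x = counit x;
  ev_mul : forall (a b : A) (x : G),
    ev (a * b) x = \sum_(y <- cop x) ev a y.1 * ev b y.2;
  ev_cop : forall (N : nat) (rho : {linear G -> 'M[laurent]_N})
      (c : 'I_N -> 'I_N -> A),
    admissible rho -> (forall i j (x : G), ev (c i j) x = rho x i j) ->
    forall i j, teq (cop (c i j)) [seq (c i l, c l j) | l <- enum 'I_N];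
  ev_counit : forall a : A, counit a = ev a 1;
  ev_antipode : forall (a : A) (x : G), ev (antipode a) x = ev a (antipode x)
}.

End Gamma.

End RootData.

(* O is A (x)_R k, with iota a = a (x) 1. *)
Record is_base_change (k : comNzRingType) (sp : {rmorphism laurent -> k})
    (A : hopf laurent) (O : hopf k) (iota : {rmorphism A -> O}) : Prop := {
  iota_scale : forall (r : laurent) (a : A), iota (r *: a) = sp r *: iota a;
  iota_univ : forall (M : lmodType k) (g : {additive A -> M}),
    (forall (r : laurent) (a : A), g (r *: a) = sp r *: g a) ->
    exists2 h : {linear O -> M}, (forall a, h (iota a) = g a) &
      forall h' : {linear O -> M}, (forall a, h' (iota a) = g a) -> h' =1 h;
  iota_cop : forall a : A,
    teq (cop (iota a)) [seq (iota x.1, iota x.2) | x <- cop a];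
  iota_counit : forall a : A, counit (iota a) = sp (counit a);
  iota_antipode : forall a : A, antipode (iota a) = iota (antipode a)
}.

(* O is R_q^phi[G] (x)_R k. *)
Definition is_Oq_at (C : cartan_datum) (tw : twisting C) (k : comNzRingType)
    (sp : {rmorphism laurent -> k}) (O : hopf k) : Prop :=
  exists (U : hopf Qq) (E F : 'I_(rk C) -> U) (K : rootQ C -> U)
    (G : hopf laurent) (incl : {rmorphism G -> U})
    (A : hopf laurent) (ev : A -> G -> laurent) (iota : {rmorphism A -> O}),
  [/\ is_Uq tw E F K, is_Gamma E F K incl, is_Rq K incl ev &
      is_base_change sp iota].

(* Main.v *)
From HB Require Import structures.
Require Import Defs.
From mathcomp Require Import all_boot all_order all_algebra all_field.
From mathcomp Require Import sesquilinear boolp ring.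
Import Order.TTheory GRing.Theory Num.Theory.
Local Open Scope ring_scope.

Set Implicit Arguments.
Unset Strict Implicit.
Unset Printing Implicit Defensive.

(** The twisted and the untwisted enveloping algebras have the same
    presentation, so they are the same algebra U, with the same form Gamma;
    only the coproducts differ. Hence the two function algebras are spanned
    by the same matrix coefficients, with the same coproduct, counit and
    unit, and differ only by their products, which are dual to the
    coproducts of U.

    On a tensor product of two representations with weight bases, let J act
    on vectors of weights lambda and mu by q^{(phi lambda, mu) / 2}. The
    relation phi alpha_i = 2 tau_i gives, on generators and hence
    everywhere, Delta_phi(x) = J Delta(x) J^{-1} ([twisted_tensor_entry]).
    For the entries c_ij and c'_pq of two representations whose basis
    vectors have weights w and w', this says that the twisted product of
    c_ij and c'_pq is q^{(phi w_i, w'_p) / 2 - (phi w_j, w'_q) / 2} c_ij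
    c'_pq ([Rq_iso_mul_entries]).

    This is the product of a cocycle deformation. Restricting functions to
    the torus is a Hopf map from the function algebra to the group algebra
    of the weight lattice: it sends c_ij to delta_ij times the weight w_i.
    The bicharacter q^{(phi lambda, mu) / 2} of the weight lattice is a
    2-cocycle on that group algebra, and its pullback sigma satisfies
    sigma(c_ij, c'_pq) = delta_ij delta_pq q^{(phi w_i, w'_p) / 2}
    ([torus_form_conv], [torus_form_cocycle], [cocycle_mul_comatrix]).

    The restriction to the torus has to be constructed from the values of a
    function on the elements K_l. These determine its weights and
    coefficients because distinct characters of the torus are linearly
    independent over Q(q) ([wsum_eq]); that is no longer so at a root of
    unity, so the construction is carried out over R and then extended along
    the base change ([torus_functional_ex]). The exponents (phi lambda, mu)
    / 2 are integers, so the values of sigma lie in R and can be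
    specialized. *)

(** * Submodules and subalgebras as types *)

Section SubmoduleType.
Variables (k : comNzRingType) (V : lmodType k) (P : V -> Prop).
Hypotheses (P0 : P 0) (PP : forall c x y, P x -> P y -> P (c *: x + y)).

Definition submod_pred : {pred V} := fun x => `[< P x >].

Lemma submod_pred_closed : GRing.submod_closed submod_pred.
Proof.
split=> [|c x y /asboolP Px /asboolP Py]; apply/asboolP => //; exact: PP.
Qed.

HB.instance Definition _ :=
  GRing.isSubmodClosed.Build k V submod_pred
    (GRing.submod_closed_semi submod_pred_closed).

Record submod := Submod { submod_val : V; _ : submod_val \in submod_pred }.

HB.instance Definition _ := [isSub for submod_val].
HB.instance Definition _ := [Choice of submod by <:].
HB.instance Definition _ := [SubChoice_isSubLmodule of submod by <:].

(** A universal property only speaks of maps between types. Turning the set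
    of elements satisfying a property P into a module lets the uniqueness
    half of such a property show that P holds everywhere. *)
Lemma submodule_type : exists (W : lmodType k) (i : {linear W -> V}),
  [/\ injective i, forall w, P (i w) & forall x, P x -> exists w, i w = x].
Proof.
exists (submod : lmodType k), (val : {linear submod -> V}); split.
- exact: val_inj.
- by case=> x Px; exact/asboolP.
- by move=> x Px; exists (Submod (asboolT Px)).
Qed.
End SubmoduleType.

Section SubalgebraType.
Variables (k : comNzRingType) (A : algType k) (P : A -> Prop).
Hypotheses (P1 : P 1) (PP : forall c x y, P x -> P y -> P (c *: x + y)).
Hypothesis PM : forall x y, P x -> P y -> P (x * y).

Definition subalg_pred : {pred A} := fun x => `[< P x >].

Lemma subalg_pred_closed : GRing.subalg_closed subalg_pred.
Proof.
split=> [|c x y /asboolP Px /asboolP Py|x y /asboolP Px /asboolP Py];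
  apply/asboolP => //; [exact: PP|exact: PM].
Qed.

HB.instance Definition _ :=
  GRing.isSubalgClosed.Build k A subalg_pred
    (GRing.subalg_closed_semi subalg_pred_closed).

Record subalg := Subalg { subalg_val : A; _ : subalg_val \in subalg_pred }.

HB.instance Definition _ := [isSub for subalg_val].
HB.instance Definition _ := [Choice of subalg by <:].
HB.instance Definition _ := [SubChoice_isSubAlgebra of subalg by <:].

Definition subalg_incl : subalg -> A := val.
HB.instance Definition _ := GRing.Linear.on subalg_incl.
HB.instance Definition _ := GRing.RMorphism.on subalg_incl.

Lemma subalgebra_type : exists (B : algType k) (i : {lrmorphism B -> A}),
  [/\ injective i, forall b, P (i b) & forall x, P x -> exists b, i b = x].
Proof.
exists (subalg : algType k), (subalg_incl : {lrmorphism subalg -> A}); split.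
- exact: val_inj.
- by case=> x Px; exact/asboolP.
- by move=> x Px; exists (Subalg (asboolT Px)).
Qed.
End SubalgebraType.

(** * Multilinear maps and Sweedler sums *)

(** Linearity as a plain property of functions: Sweedler sums produce
    anonymous functions, for which no bundled linear structure can be
    inferred. *)
Definition lin (k : comNzRingType) (V M : lmodType k) (f : V -> M) : Prop :=
  forall c x y, f (c *: x + y) = c *: f x + f y.

Definition slin (k : comNzRingType) (V : lmodType k) (f : V -> k) :=
  forall c x y, f (c *: x + y) = c * f x + f y.

Section Lin.
Variable k : comNzRingType.
Implicit Types V M : lmodType k.

Lemma lin0 V M (f : V -> M) : lin f -> f 0 = 0.
Proof.
by move=> fl; have := fl (-1) 0 0; rewrite scaler0 addr0 scaleN1r addNr.
Qed.

Lemma slin0 V (f : V -> k) : slin f -> f 0 = 0.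
Proof. exact: (@lin0 V k^o). Qed.

Lemma lin_bundle V M (f : V -> M) :
  lin f -> exists g : {linear V -> M}, g =1 f.
Proof.
move=> fl.
pose g : {linear V -> M} := HB.pack f (GRing.isLinear.Build k V M *:%R f fl).
by exists g.
Qed.

Lemma lin_sum V M (I : Type) (r : seq I) (f : I -> V -> M) :
  (forall i, lin (f i)) -> lin (fun x => \sum_(i <- r) f i x).
Proof.
move=> fl c x y; rewrite scaler_sumr -big_split; apply: eq_bigr => i _.
exact: fl.
Qed.

Lemma slin_mull V (f : V -> k) (a : k) : slin f -> slin (fun x => f x * a).
Proof. by move=> fl c x y; rewrite fl mulrDl mulrA. Qed.

Lemma slin_mulr V (f : V -> k) (a : k) : slin f -> slin (fun x => a * f x).
Proof. by move=> fl c x y; rewrite fl mulrDr mulrCA. Qed.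

Lemma lin_mull (A : algType k) (b : A) : lin (fun x => x * b).
Proof. by move=> c x y; rewrite mulrDl scalerAl. Qed.

Lemma lin_mulr (A : algType k) (b : A) : lin (fun x => b * x).
Proof. by move=> c x y; rewrite mulrDr scalerAr. Qed.

Lemma slin_comp V M (f : V -> M) (g : M -> k) :
  lin f -> slin g -> slin (fun x => g (f x)).
Proof. by move=> fl gl c x y; rewrite fl gl. Qed.

Lemma slin_counit (H : hopf k) : slin (fun a : H => counit a).
Proof. by move=> c x y; rewrite linearP. Qed.
End Lin.

Section Tensors.
Variables (k : comNzRingType).

Definition bilin (V W M : lmodType k) (F : V -> W -> M) : Prop :=
  (forall y c x x', F (c *: x + x') y = c *: F x y + F x' y) /\
  (forall x c y y', F x (c *: y + y') = c *: F x y + F x y').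

Lemma teq_bilin (V W M : lmodType k) (F : V -> W -> M) s t :
  bilin F -> teq s t -> \sum_(p <- s) F p.1 p.2 = \sum_(p <- t) F p.1 p.2.
Proof.
move=> [Fl Fr] st.
pose FB := bilinear_isBilinear.Build k V W M *:%R *:%R F
  ((fun u' c x y => Fl u' c x y), (fun u c x y => Fr u c x y)).
pose G : {bilinear V -> W -> M} := HB.pack F FB.
exact: (st M G).
Qed.

(** [cop a] is a chosen family, so a sum over it depends linearly on [a]
    only when the summand is bilinear, that is, when it factors through the
    tensor product. *)
Lemma cop_linear_sum (H : hopf k) (M : lmodType k) (F : H -> H -> M) :
  bilin F -> forall c a b,
  \sum_(x <- cop (c *: a + b)) F x.1 x.2 =
  c *: \sum_(x <- cop a) F x.1 x.2 + \sum_(x <- cop b) F x.1 x.2.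
Proof.
move=> HF c a b; rewrite (teq_bilin HF (cop_linear (hopfP H) c a b)).
rewrite big_cat big_map scaler_sumr; congr (_ + _); apply: eq_bigr => x _ /=.
have F0 y : F 0 y = 0 := lin0 (HF.1 y).
by have := HF.1 x.2 c x.1 0; rewrite !addr0 F0 addr0.
Qed.

Lemma bilin_mul (V W : lmodType k) (f : V -> k) (h : W -> k) :
  slin f -> slin h -> bilin (fun x y => f x * h y : k^o).
Proof.
move=> fl hl; split=> [y c x x'|x c y y'] /=.
  by rewrite fl mulrDl -mulrA.
by rewrite hl mulrDr mulrCA.
Qed.
End Tensors.

(** * Laurent polynomials inside Q(q) *)

Lemma qv_neq0 : qv != 0.
Proof. by rewrite /qv tofrac_eq0 polyX_eq0. Qed.

(** q is not a root of unity: this is what makes weights visible in the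
    eigenvalues of the K_l. *)
Lemma qv_expz_inj : injective (fun z : int => qv ^ z).
Proof.
have nat1 (n : nat) : qv ^+ n = 1 -> n = 0%N.
  move=> /eqP; rewrite /qv -tofracXn -tofrac1 tofrac_eq =>
    /eqP/(congr1 (fun p : {poly rat} => size p)).
  by rewrite size_polyXn size_poly1 => -[].
have int1 (z : int) : qv ^ z = 1 -> z = 0.
  case: z => n; first by rewrite -exprnP => /nat1 ->.
  rewrite NegzE -exprnN => /eqP; rewrite invr_eq1 => /eqP/nat1 //.
move=> x y /= xy; apply/eqP; rewrite -subr_eq0; apply/eqP/int1.
by rewrite expfzDr ?qv_neq0 // xy -expfzDr ?qv_neq0 // subrr expr0z.
Qed.

Lemma qv_expz_laurent (z : int) : qv ^ z \in laurent_pred.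
Proof.
apply/asboolP; case: z => n.
  by exists 0%N, 'X^n; rewrite expr0 mulr1 -exprnP tofracXn.
exists n.+1, 1; rewrite NegzE -exprnN mulVf ?tofrac1 //.
by rewrite expf_neq0 // qv_neq0.
Qed.

(** Negative powers of q exist over R: this is what lets the cocycle and its
    inverse be specialized. *)
Definition lq (z : int) : laurent := Laurent (qv_expz_laurent z).

Lemma lvalM (r s : laurent) : val (r * s) = val r * val s.
Proof. exact: rmorphM. Qed.

Lemma lvalD (r s : laurent) : val (r + s) = val r + val s.
Proof. exact: rmorphD. Qed.

Lemma lval_neq0 (r : laurent) : (val r != 0) = (r != 0).
Proof. by rewrite -(inj_eq val_inj) rmorph0. Qed.

Lemma laurent_mulf_neq0 (r s : laurent) : r != 0 -> s != 0 -> r * s != 0.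
Proof.
move=> r0 s0; rewrite -(lval_neq0 (r * s)) lvalM.
have r1 : val r != 0 by rewrite (lval_neq0 r).
have s1 : val s != 0 by rewrite (lval_neq0 s).
exact: (mulf_neq0 r1 s1).
Qed.

Lemma lqD x y : lq (x + y) = lq x * lq y.
Proof. by apply: val_inj; rewrite /= expfzDr // qv_neq0. Qed.

Lemma lq0 : lq 0 = 1.
Proof. by apply: val_inj. Qed.

Lemma tofrac_laurent (p : {poly rat}) : tofrac p \in laurent_pred.
Proof. by apply/asboolP; exists 0%N, p; rewrite expr0 mulr1. Qed.

Lemma fraction_laurent (c : Qq) :
  exists r s : laurent, r != 0 /\ val r * c = val s.
Proof.
elim/quotW: c => x.
exists (Laurent (tofrac_laurent \d_x)), (Laurent (tofrac_laurent \n_x)).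
have dx0 : \d_x != 0 by exact: denom_ratioP.
split; first by rewrite -val_eqE /= tofrac_eq0.
rewrite /GRing.mul /= !piE; apply/eqmodP; rewrite /= FracField.equivfE.
by rewrite !numden_Ratio ?mulf_neq0 ?oner_neq0 // mulr1 mul1r.
Qed.

Notation lmap := (map_mx (val : laurent -> Qq)).

Lemma lmapZ m n r (A : 'M[laurent]_(m, n)) :
  lmap (r *: A) = val r *: lmap A.
Proof. by apply/matrixP => i j; rewrite !mxE; exact: lvalM. Qed.

Lemma lmapD m n (A B : 'M[laurent]_(m, n)) : lmap (A + B) = lmap A + lmap B.
Proof. by apply/matrixP => i j; rewrite !mxE; exact: rmorphD. Qed.

Lemma lmapM m n p (A : 'M[laurent]_(m, n)) (B : 'M_(n, p)) :
  lmap (A *m B) = lmap A *m lmap B.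
Proof.
apply/matrixP => i j; rewrite !mxE rmorph_sum; apply: eq_bigr => l _.
by rewrite !mxE; exact: lvalM.
Qed.

(** * Generation and uniqueness of the quantized enveloping algebra *)

Lemma Uq_relations_inj (C : cartan_datum) (A B : algType Qq)
    (f : {lrmorphism B -> A}) (E F : 'I_(rk C) -> B) (K : rootQ C -> B)
    (E' F' : 'I_(rk C) -> A) (K' : rootQ C -> A) :
  injective f -> preserves_generators f E F K E' F' K' ->
  Uq_relations E' F' K' -> Uq_relations E F K.
Proof.
move=> finj [fE fF fK] [K0 KD KE KF EF ES FS]; split.
- by apply: finj; rewrite fK rmorph1 K0.
- by move=> l m; apply: finj; rewrite rmorphM /= !fK KD.
- by move=> l j; apply: finj; rewrite !rmorphM linearZ /= !fK fE KE.
- by move=> l j; apply: finj; rewrite !rmorphM linearZ /= !fK fF KF.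
- move=> i j; apply: finj; rewrite rmorphB !rmorphM /= !fE !fF EF.
  by case: eqP => _; rewrite ?rmorph0 // linearZ rmorphB /= !fK.
- move=> i j ij; apply: finj; rewrite rmorph0 linear_sum -[RHS](ES i j ij).
  by apply: eq_bigr => s _; rewrite linearZ !rmorphM !rmorphXn /= !fE.
- move=> i j ij; apply: finj; rewrite rmorph0 linear_sum -[RHS](FS i j ij).
  by apply: eq_bigr => s _; rewrite linearZ !rmorphM !rmorphXn /= !fF.
Qed.

Section Uq.
Variables (C : cartan_datum) (tw : twisting C) (U : hopf Qq).
Variables (E F : 'I_(rk C) -> U) (K : rootQ C -> U).
Hypothesis HU : is_Uq tw E F K.

Lemma Uq_endo_id (h : {lrmorphism U -> U}) :
  preserves_generators h E F K E F K -> h =1 id.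
Proof.
move=> hP u; have [g _ gu] := Uq_univ HU (Uq_rel HU).
rewrite (gu h hP u); symmetry.
by apply: (gu (idfun : {lrmorphism U -> U})); split.
Qed.

(** U_q(g) has no proper subalgebra containing the generators: the universal
    property gives a morphism into such a subalgebra, and composed with the
    inclusion it fixes the generators, hence is the identity. *)
Lemma Uq_ind (P : U -> Prop) :
  P 1 -> (forall c x y, P x -> P y -> P (c *: x + y)) ->
  (forall x y, P x -> P y -> P (x * y)) ->
  (forall i, P (E i)) -> (forall i, P (F i)) -> (forall l, P (K l)) ->
  forall u, P u.
Proof.
move=> P1 PP PM PE PF PK u.
have [B [f [finj fP fex]]] := subalgebra_type P1 PP PM.
have [E' fE] := choice (fun i => fex _ (PE i)).
have [F' fF] := choice (fun i => fex _ (PF i)).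
have [K' fK] := choice (fun l => fex _ (PK l)).
have rel : Uq_relations E' F' K'.
  by apply: (Uq_relations_inj finj _ (Uq_rel HU)); split.
have [g [gE gF gK] _] := Uq_univ HU rel.
have /= <- := @Uq_endo_id (f \o g : {lrmorphism U -> U}) _ u; first exact: fP.
by split=> i /=; rewrite ?gE ?gF ?gK ?fE ?fF ?fK.
Qed.
End Uq.

(** The twist only changes the coproduct. *)
Lemma Uq_iso (C : cartan_datum) (tw tw' : twisting C) (U U' : hopf Qq)
    (E F : 'I_(rk C) -> U) (K : rootQ C -> U)
    (E' F' : 'I_(rk C) -> U') (K' : rootQ C -> U') :
  is_Uq tw E F K -> is_Uq tw' E' F' K' ->
  exists (g : {lrmorphism U -> U'}) (g' : {lrmorphism U' -> U}),
  [/\ preserves_generators g E F K E' F' K',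
      preserves_generators g' E' F' K' E F K, cancel g g' & cancel g' g].
Proof.
move=> HU HU'.
have [g gP _] := Uq_univ HU (Uq_rel HU').
have [g' gP' _] := Uq_univ HU' (Uq_rel HU).
exists g, g'; split => //.
- apply: (Uq_endo_id HU (h := (g' \o g : {lrmorphism U -> U}))).
  by case: gP gP' => [a b c] [a' b' c']; split=> i /=; rewrite ?a ?b ?c.
- apply: (Uq_endo_id HU' (h := (g \o g' : {lrmorphism U' -> U'}))).
  by case: gP gP' => [a b c] [a' b' c']; split=> i /=; rewrite ?a' ?b' ?c'.
Qed.

(** * Weights and the exponent of the twist *)

Lemma row_int_ind (n : nat) (P : 'rV[int]_n -> Prop) :
  P 0 -> (forall l m, P l -> P m -> P (l + m)) -> (forall l, P l -> P (- l)) ->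
  (forall i, P (delta_mx 0 i)) -> forall l, P l.
Proof.
move=> P0 PD PN Pd l; rewrite (row_sum_delta l).
elim/big_ind: _ => // i _; rewrite -[l 0 i]intz scaler_int.
have Pn (x : 'rV[int]_n) (k : nat) : P x -> P (x *+ k).
  by move=> Px; elim: k => [|k IH]; rewrite ?mulr0n // mulrS; apply: PD.
case: (l 0 i) => k; first exact: Pn.
by rewrite NegzE mulrNz; apply/PN/Pn.
Qed.

Section Weights.
Variable C : cartan_datum.
Local Notation n := (rk C).
Implicit Types (l : rootQ C) (w : 'rV[int]_n).

(** A weight is given by its coordinates w on the fundamental weights; then
    [kpair l w] is (l, w), the exponent of the eigenvalue of K_l on a vector
    of weight w. *)
Definition kpair l w : int := \sum_i l 0 i * (dd i)%:Z * w 0 i.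

Lemma kpairDl l m w : kpair (l + m) w = kpair l w + kpair m w.
Proof. by rewrite -big_split; apply: eq_bigr => i _; rewrite mxE !mulrDl. Qed.

Lemma kpairNl l w : kpair (- l) w = - kpair l w.
Proof.
by rewrite /kpair -sumrN; apply: eq_bigr => i _; rewrite mxE !mulNr.
Qed.

Lemma kpair0l w : kpair 0 w = 0.
Proof. by rewrite /kpair big1 // => i _; rewrite mxE !mul0r. Qed.

Lemma kpairDr l v w : kpair l (v + w) = kpair l v + kpair l w.
Proof. by rewrite -big_split; apply: eq_bigr => i _; rewrite mxE mulrDr. Qed.

Lemma kpairNr l w : kpair l (- w) = - kpair l w.
Proof.
by rewrite /kpair -sumrN; apply: eq_bigr => i _; rewrite mxE mulrN.
Qed.

Lemma kpair0r l : kpair l 0 = 0.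
Proof. by rewrite /kpair big1 // => i _; rewrite mxE mulr0. Qed.

Lemma kpair_alpha i w : kpair (alpha i) w = (dd i)%:Z * w 0 i.
Proof.
rewrite /kpair (bigD1 i) //= big1 => [|j ji]; last first.
  by rewrite /alpha mxE eqxx (negPf ji) !mul0r.
by rewrite /alpha mxE !eqxx mul1r addr0.
Qed.

Lemma gram_sym : (gram C)^T = gram C.
Proof. by apply/matrixP => i j; rewrite !mxE cartan_sym. Qed.

Lemma gramQ_sym : (gramQ C)^T = gramQ C.
Proof. by rewrite /gramQ map_trmx gram_sym. Qed.

(** A kernel vector of the Gram matrix would be isotropic. *)
Lemma gramQ_unit : gramQ C \in unitmx.
Proof.
rewrite unitmxE unitfE; apply/det0P => -[v v0 vG].
have := cartan_posdef v0.
suff -> : \sum_i \sum_j v 0 i * v 0 j * ((dd i)%:Z * cartan C i j)%:~R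
          = (v *m gramQ C *m v^T) 0 0 by rewrite vG mul0mx mxE ltxx.
rewrite mxE exchange_big; apply: eq_bigr => j _ /=.
rewrite mxE mulr_suml; apply: eq_bigr => i _.
by rewrite !mxE mulrAC.
Qed.

Definition weight_vec w : spaceQ C := \sum_i (w 0 i)%:~R *: omega i.

Lemma weight_vec_weight w : weight (weight_vec w).
Proof. by exists (w 0). Qed.

Lemma weight_vecD v w : weight_vec (v + w) = weight_vec v + weight_vec w.
Proof.
by rewrite -big_split; apply: eq_bigr => i _; rewrite mxE rmorphD scalerDl.
Qed.

(** The simple root alpha_p in the coordinates of the fundamental weights. *)
Definition root_wt (p : 'I_n) : 'rV[int]_n := \row_i cartan C i p.

Lemma kpair_root l p : kpair l (root_wt p) = pairQ l (alpha p).
Proof.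
rewrite /pairQ /alpha trmx_delta -colE !mxE; apply: eq_bigr => j _.
by rewrite !mxE mulrA.
Qed.

Lemma weight_vecE w :
  weight_vec w = (\row_i ((dd i)%:Z * w 0 i)%:~R) *m invmx (gramQ C).
Proof.
rewrite mulmx_sum_row; apply: eq_bigr => i _.
by rewrite /omega scalerA mxE rmorphM mulrC.
Qed.

Lemma weight_vec_root p : weight_vec (root_wt p) = qroot (alpha p).
Proof.
rewrite weight_vecE /alpha /qroot map_delta_mx.
suff -> : \row_i ((dd i)%:Z * (root_wt p) 0 i)%:~R =
  (delta_mx 0 p : 'rV_n) *m gramQ C.
  by rewrite mulmxK // gramQ_unit.
by apply/rowP => i; rewrite -rowE !mxE cartan_sym.
Qed.

Lemma pair_weight_vec l w : pair (qroot l) (weight_vec w) = (kpair l w)%:~R.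
Proof.
rewrite /pair weight_vecE trmx_mul trmx_inv gramQ_sym -mulmxA mulKVmx
  ?gramQ_unit //.
rewrite mxE rmorph_sum; apply: eq_bigr => i _.
by rewrite !mxE -rmorphM mulrA.
Qed.

Lemma pair_sym (x y : spaceQ C) : pair x y = pair y x.
Proof.
have tr0 (M : 'M[rat]_1) : M 0 0 = M^T 0 0 by rewrite mxE.
by rewrite /pair tr0 !trmx_mul gramQ_sym trmxK mulmxA.
Qed.

Lemma pairDl (x y z : spaceQ C) : pair (x + y) z = pair x z + pair y z.
Proof. by rewrite /pair !mulmxDl mxE. Qed.
Lemma pairDr (x y z : spaceQ C) : pair x (y + z) = pair x y + pair x z.
Proof. by rewrite !(pair_sym x) pairDl. Qed.
Lemma pairZl c (x z : spaceQ C) : pair (c *: x) z = c * pair x z.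
Proof. by rewrite /pair -!scalemxAl mxE. Qed.
Lemma pairZr c (x z : spaceQ C) : pair x (c *: z) = c * pair x z.
Proof. by rewrite !(pair_sym x) pairZl. Qed.

Variable tw : twisting C.

(** The integer (phi v, w) / 2. The twisting cocycle acts on a pair of
    vectors of weights v and w by q to this power. *)
Definition twist_exp v w : int :=
  projT1 (cid (phi_half_int tw (weight_vec_weight v) (weight_vec_weight w))).

Lemma twist_expE v w :
  (twist_exp v w)%:~R = 2^-1 * pair (phi tw (weight_vec v)) (weight_vec w).
Proof. by rewrite /twist_exp; case: cid => z /= ->. Qed.

Lemma twist_expDl u v w : twist_exp (u + v) w = twist_exp u w + twist_exp v w.
Proof.
apply: (@intr_inj rat); rewrite rmorphD /= !twist_expE weight_vecD linearD
  pairDl.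
by rewrite mulrDr.
Qed.

Lemma twist_expDr u v w : twist_exp u (v + w) = twist_exp u v + twist_exp u w.
Proof.
by apply: (@intr_inj rat); rewrite rmorphD /= !twist_expE weight_vecD pairDr
  mulrDr.
Qed.

Lemma twist_exp0l w : twist_exp 0 w = 0.
Proof. by apply: (addIr (twist_exp 0 w)); rewrite -twist_expDl !add0r. Qed.

Lemma twist_exp0r w : twist_exp w 0 = 0.
Proof. by apply: (addIr (twist_exp w 0)); rewrite -twist_expDr !add0r. Qed.

(** This identity and the next are where phi alpha_p = 2 tau_p enters:
    moving one weight by a simple root changes the exponent by what
    K_{tau_p} does on the other factor. *)
Lemma twist_exp_rootl p w : twist_exp (root_wt p) w = kpair (tau tw p) w.
Proof.
apply: (@intr_inj rat); rewrite twist_expE weight_vec_root phi_alpha pairZl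
  mulKf //.
exact: pair_weight_vec.
Qed.

Lemma twist_exp_rootr p w : twist_exp w (root_wt p) = - kpair (tau tw p) w.
Proof.
apply: (@intr_inj rat); rewrite twist_expE weight_vec_root phi_antisym phi_alpha
  pairZr.
by rewrite mulrN mulKf // pair_sym pair_weight_vec rmorphN.
Qed.
End Weights.

(** * Extending representations from Gamma to U_q(g) *)

Lemma qi_expz (C : cartan_datum) (i : 'I_(rk C)) (z : int) :
  qi i ^ z = qv ^ ((dd i)%:Z * z).
Proof. by rewrite /qi exprnP exprz_exp. Qed.

Lemma qi_neq1 (C : cartan_datum) (i : 'I_(rk C)) : qi i != 1.
Proof.
apply/eqP => /(@qv_expz_inj (dd i)%:Z 0) [] di0.
by have := dd_gt0 i; rewrite di0.
Qed.

Lemma qint1 (C : cartan_datum) (i : 'I_(rk C)) : qint (qi i) 1 = 1.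
Proof.
rewrite /qint expr1 divff // subr_eq0; apply/eqP.
rewrite /qi exprnN => /(@qv_expz_inj (dd i)%:Z (- (dd i)%:Z)) di0.
have := dd_gt0 i; case: (dd i) di0 => // d.
Qed.

(** The form Gamma spans U_q(g) over Q(q), so a representation of Gamma over
    R extends to U_q(g). The extension is needed because the coproduct of
    U_q(g) is given on generators as an element of the tensor square over
    Q(q), on which only functions bilinear over Q(q) are defined. *)
Section Gamma.
Variables (C : cartan_datum) (tw : twisting C) (U : hopf Qq).
Variables (E F : 'I_(rk C) -> U) (K : rootQ C -> U).
Hypothesis HU : is_Uq tw E F K.
Variables (G : hopf laurent) (incl : {rmorphism G -> U}).
Hypothesis HG : is_Gamma E F K incl.

Let K0 : K 0 = 1 := K_zero (Uq_rel HU).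
Let KD l m : K (l + m) = K l * K m := K_add (Uq_rel HU) l m.

Lemma in_Gamma_E i : in_Gamma E F K (E i).
Proof.
have := @Gamma_E _ _ E F K i 1 isT.
by rewrite /divided_power /qfact big_nat1 qint1 invr1 scale1r expr1.
Qed.

Lemma in_Gamma_F i : in_Gamma E F K (F i).
Proof.
have := @Gamma_F _ _ E F K i 1 isT.
by rewrite /divided_power /qfact big_nat1 qint1 invr1 scale1r expr1.
Qed.

(** K_{alpha_i} itself is not among the generators of Gamma, but it is
    affine in the first of the K-binomials. *)
Lemma in_Gamma_Kalpha i : in_Gamma E F K (K (alpha i)).
Proof.
have -> : K (alpha i) = (val (lq (dd i)) - 1) *: K_binom K i 1 + 1.
  rewrite /K_binom big_nat1 expr1 scalerA divff; last first.
    by rewrite subr_eq0 qi_neq1.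
  by rewrite subrr expr0z !scale1r subrK.
apply: Gamma_add; last exact: Gamma_one.
apply: (@Gamma_scale _ _ _ _ _ (lq (dd i) - 1)); exact: Gamma_Kbinom.
Qed.

Lemma in_Gamma_K l : in_Gamma E F K (K l).
Proof.
suff [] : in_Gamma E F K (K l) /\ in_Gamma E F K (K (- l)) by [].
elim/row_int_ind: l => [|l m [Pl PNl] [Pm PNm]|l [Pl PNl]|i].
- by rewrite oppr0 K0; split; apply: Gamma_one.
- by rewrite opprD !KD; split; apply: Gamma_mul.
- by rewrite opprK.
- split; [exact: in_Gamma_Kalpha|exact: Gamma_Kinv].
Qed.

Lemma in_Gamma_ex u : in_Gamma E F K u -> exists x : G, incl x = u.
Proof. exact: (incl_image HG u).1. Qed.

Lemma clear_denominators (c : Qq) (r s d e : laurent) u v (x y : G) :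
  val r *: u = incl x -> val s *: v = incl y -> val d * c = val e ->
  val (d * (r * s)) *: (c *: u + v) = incl ((e * s) *: x + (d * r) *: y).
Proof.
move=> ru sv de; rewrite rmorphD !(incl_scale HG) -ru -sv scalerDr !scalerA.
rewrite !lvalM -de; congr (_ *: _ + _ *: _); last by rewrite mulrA.
by rewrite -!mulrA; congr (_ * _); rewrite mulrCA [val r * c]mulrC mulrCA.
Qed.

(** Fractions with numerator in Gamma form a subalgebra containing the
    generators. *)
Lemma Gamma_frac u :
  exists (r : laurent) (x : G), r != 0 /\ val r *: u = incl x.
Proof.
have frac1 v : in_Gamma E F K v ->
    exists (r : laurent) (x : G), r != 0 /\ val r *: v = incl x.
  move=> /in_Gamma_ex[x xE]; exists 1, x; split; first exact: oner_neq0.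
  by rewrite xE; exact: scale1r.
elim/(Uq_ind HU): u => [|c u v [r [x [r0 ru]]] [s [y [s0 sv]]]|
    u v [r [x [r0 ru]]] [s [y [s0 sv]]]|i|i|l].
- exact: frac1 (Gamma_one _ _ _).
- have [d [e [d0 de]]] := fraction_laurent c.
  exists (d * (r * s)), ((e * s) *: x + (d * r) *: y).
  split; last exact: clear_denominators ru sv de.
  exact: laurent_mulf_neq0 d0 (laurent_mulf_neq0 r0 s0).
- exists (r * s), (x * y); split; first exact: laurent_mulf_neq0.
  by rewrite lvalM rmorphM -ru -sv -scalerAl -scalerAr scalerA.
- exact: frac1 (in_Gamma_E i).
- exact: frac1 (in_Gamma_F i).
- exact: frac1 (in_Gamma_K l).
Qed.

Section Extension.
Variables (N : nat) (rho : {linear G -> 'M[laurent]_N}).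

(** The value does not depend on the fraction, as Gamma is torsion free. *)
Lemma ext_rep_ex (u : U) : exists M : 'M[Qq]_N, forall (r : laurent) (x : G),
  r != 0 -> val r *: u = incl x -> M = (val r)^-1 *: lmap (rho x).
Proof.
have [s [y [s0 su]]] := Gamma_frac u.
exists ((val s)^-1 *: lmap (rho y)) => r x r0 ru.
have xy : s *: x = r *: y.
  by apply: (incl_inj HG); rewrite !(incl_scale HG) -ru -su !scalerA mulrC.
have {}xy : lmap (rho (s *: x)) = lmap (rho (r *: y)) by rewrite xy.
rewrite !linearZ !lmapZ in xy.
have vr0 : val r != 0 by rewrite lval_neq0.
have vs0 : val s != 0 by rewrite lval_neq0.
apply: (scalerI vr0); rewrite scalerA mulrC -scalerA -xy.
by rewrite !scalerA (mulVf vs0) (divff vr0).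
Qed.

Definition ext_rep (u : U) : 'M[Qq]_N := projT1 (cid (ext_rep_ex u)).

Lemma ext_repE (r : laurent) x u : r != 0 -> val r *: u = incl x ->
  ext_rep u = (val r)^-1 *: lmap (rho x).
Proof. by rewrite /ext_rep; case: cid => M MP; exact: MP. Qed.

Lemma ext_rep_incl x : ext_rep (incl x) = lmap (rho x).
Proof.
rewrite (@ext_repE 1 x _ (oner_neq0 _) (scale1r _)).
by rewrite rmorph1 invr1 scale1r.
Qed.

Lemma ext_rep_linear c u v : ext_rep (c *: u + v) = c *: ext_rep u + ext_rep v.
Proof.
have [r [x [r0 ru]]] := Gamma_frac u.
have [s [y [s0 sv]]] := Gamma_frac v.
have [d [e [d0 de]]] := fraction_laurent c.
have vr0 : val r != 0 by rewrite lval_neq0.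
have vs0 : val s != 0 by rewrite lval_neq0.
have vd0 : val d != 0 by rewrite lval_neq0.
rewrite (ext_repE r0 ru) (ext_repE s0 sv).
have drs0 := laurent_mulf_neq0 d0 (laurent_mulf_neq0 r0 s0).
rewrite (ext_repE drs0 (clear_denominators ru sv de)).
rewrite linearD (linearZ_LR rho) (linearZ_LR rho) lmapD !lmapZ scalerDr !scalerA
  !lvalM -de.
have frac (k : fieldType) (a b c' d' : k) : d' != 0 -> a != 0 -> b != 0 ->
    (d' * (a * b))^-1 * (d' * c' * b) = c' * a^-1 /\
    (d' * (a * b))^-1 * (d' * a) = b^-1.
  by move=> d'0 a0 b0; split; field; rewrite d'0 a0 b0.
have [-> ->] := frac _ _ _ c _ vd0 vr0 vs0.
by [].
Qed.
End Extension.
End Gamma.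

(** * Weight representations *)

(** A representation in which the a-th basis vector has weight [w a]. The
    last two fields say that E_p raises and F_p lowers the weight by
    alpha_p. *)
Record weight_rep (C : cartan_datum) (U : hopf Qq) (E F : 'I_(rk C) -> U)
    (K : rootQ C -> U) (N : nat) (X : U -> 'M[Qq]_N)
    (w : 'I_N -> 'rV[int]_(rk C)) : Prop := {
  wrep_linear : forall c u v, X (c *: u + v) = c *: X u + X v;
  wrep1 : X 1 = 1%:M;
  wrepM : forall u v, X (u * v) = X u *m X v;
  wrepK : forall l a b, X (K l) a b = qv ^ kpair l (w a) *+ (a == b);
  wrepE : forall p a b, X (E p) a b != 0 -> w a = w b + root_wt p;
  wrepF : forall p a b, X (F p) a b != 0 -> w b = w a + root_wt p
}.

Section Rep.
Variables (C : cartan_datum) (tw : twisting C) (U : hopf Qq).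
Variables (E F : 'I_(rk C) -> U) (K : rootQ C -> U).
Hypothesis HU : is_Uq tw E F K.
Variables (G : hopf laurent) (incl : {rmorphism G -> U}).
Hypothesis HG : is_Gamma E F K incl.
Variables (N : nat) (rho : {linear G -> 'M[laurent]_N}).
Variable m : 'I_(rk C) -> 'I_N -> int.
Hypotheses (rho1 : rho 1 = 1%:M)
  (rhoM : forall x y : G, rho (x * y) = rho x *m rho y)
  (rhoK : forall i (x : G), incl x = K (alpha i) -> forall a b : 'I_N,
     val (rho x a b) = if a == b then qi i ^ m i b else 0).

Local Notation ext_rep := (ext_rep HU HG rho).

Definition eigen_wt (a : 'I_N) : 'rV[int]_(rk C) := \row_i m i a.

Lemma ext_rep1 : ext_rep 1 = 1%:M.
Proof.
rewrite -(rmorph1 incl) ext_rep_incl rho1; apply/matrixP => i j; rewrite !mxE.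
by case: (i == j); [exact: rmorph1|exact: rmorph0].
Qed.

Lemma ext_repM u v : ext_rep (u * v) = ext_rep u *m ext_rep v.
Proof.
have [r [x [r0 ru]]] := Gamma_frac HU HG u.
have [s [y [s0 sv]]] := Gamma_frac HU HG v.
have vr0 : val r != 0 by rewrite lval_neq0.
have vs0 : val s != 0 by rewrite lval_neq0.
have xy : val (r * s) *: (u * v) = incl (x * y).
  by rewrite lvalM rmorphM -ru -sv -scalerAl -scalerAr scalerA.
rewrite (ext_repE _ _ _ r0 ru) (ext_repE _ _ _ s0 sv).
rewrite (ext_repE _ _ _ (laurent_mulf_neq0 r0 s0) xy) rhoM lmapM.
by rewrite -scalemxAl -scalemxAr scalerA lvalM invfM.
Qed.

Lemma mulmx_diag_entry (k : comNzRingType) n (d : 'I_n -> k) (A B : 'M[k]_n) :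
  (forall i j, A i j = d i *+ (i == j)) ->
  (forall i j, (A *m B) i j = d i * B i j) /\
  (forall i j, (B *m A) i j = B i j * d j).
Proof.
move=> Ad; split=> i j; rewrite mxE.
- rewrite (bigD1 i) //= big1 => [|l li]; rewrite Ad ?eqxx ?addr0 //.
  by rewrite eq_sym (negPf li) mul0r.
- rewrite (bigD1 j) //= big1 => [|l li]; rewrite Ad ?eqxx ?addr0 //.
  by rewrite (negPf li) mulr0.
Qed.

Lemma ext_rep_K l i j :
  ext_rep (K l) i j = qv ^ kpair l (eigen_wt i) *+ (i == j).
Proof.
elim/row_int_ind: l i j => [|l l' IH IH'|l IH|p] i j.
- by rewrite (K_zero (Uq_rel HU)) ext_rep1 kpair0l expr0z mxE.
- rewrite (K_add (Uq_rel HU)) ext_repM kpairDl expfzDr ?qv_neq0 //.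
  rewrite (mulmx_diag_entry _ IH').2 IH; case: eqP => [->|_] //.
  by rewrite mul0r.
- have : (ext_rep (K l) *m ext_rep (K (- l))) i j = (i == j)%:R.
    by rewrite -ext_repM -(K_add (Uq_rel HU)) subrr (K_zero (Uq_rel HU))
      ext_rep1 mxE.
  rewrite (mulmx_diag_entry _ IH).1 kpairNl => e.
  have q0 (z : int) : qv ^ z != 0 by rewrite expfz_neq0 // qv_neq0.
  apply: (mulfI (q0 (kpair l (eigen_wt i)))); rewrite e; case: eqP => [->|_].
    by rewrite mulr1n -expfzDr ?qv_neq0 // subrr expr0z.
  by rewrite mulr0n mulr0.
- have [x xE] := in_Gamma_ex HG (in_Gamma_Kalpha E F K p).
  rewrite -xE ext_rep_incl mxE (rhoK xE) kpair_alpha qi_expz mxE.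
  by case: eqP => [->|].
Qed.

(** Comparing the (a, b) entries of both sides for l = alpha_i gives the
    i-th coordinate of the weight, because q is not a root of unity. *)
Lemma ext_rep_shift X (w : 'rV[int]_(rk C)) a b :
  (forall l, K l * X * K (- l) = qv ^ kpair l w *: X) ->
  ext_rep X a b != 0 -> eigen_wt a = eigen_wt b + w.
Proof.
move=> KX X0; apply/rowP => i; apply/eqP.
have di0 : (dd i)%:Z != 0 by have := dd_gt0 i; case: (dd i).
rewrite -(inj_eq (mulfI di0)) -!kpair_alpha kpairDr; apply/eqP/qv_expz_inj.
have : ext_rep (K (alpha i) * X * K (- alpha i)) a b
       = ext_rep (qv ^ kpair (alpha i) w *: X) a b by rewrite KX.
rewrite !ext_repM -[_ *: X]addr0 ext_rep_linear.
have -> : ext_rep 0 = 0.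
  by rewrite -(rmorph0 incl) ext_rep_incl; apply/matrixP => x y;
    rewrite linear0 !mxE rmorph0.
rewrite (mulmx_diag_entry _ (ext_rep_K (- alpha i))).2.
rewrite (mulmx_diag_entry _ (ext_rep_K (alpha i))).1 addr0 [RHS]mxE kpairNl =>
  e.
apply: (mulIf X0); rewrite expfzDr ?qv_neq0 // -mulrA -e [RHS]mulrC -mulrA.
by rewrite -!mulrA -expfzDr ?qv_neq0 // addNr expr0z mulr1.
Qed.

Lemma ext_rep_E p a b :
  ext_rep (E p) a b != 0 -> eigen_wt a = eigen_wt b + root_wt p.
Proof.
apply: ext_rep_shift => l.
by rewrite (K_E (Uq_rel HU)) kpair_root.
Qed.

Lemma ext_rep_F p a b :
  ext_rep (F p) a b != 0 -> eigen_wt b = eigen_wt a + root_wt p.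
Proof.
move=> F0; rewrite (@ext_rep_shift (F p) (- root_wt p) a b) ?subrK // => l.
by rewrite (K_F (Uq_rel HU)) kpairNr kpair_root.
Qed.

Lemma ext_rep_weight_rep : weight_rep E F K ext_rep eigen_wt.
Proof.
split; [exact: ext_rep_linear|exact: ext_rep1|exact: ext_repM|exact: ext_rep_K|
  |].
- exact: ext_rep_E.
- exact: ext_rep_F.
Qed.
End Rep.

(** * The twisted coproduct on a tensor product of representations *)

Section CopEntries.
Variables (k : comNzRingType) (H : hopf k) (N N' : nat).
Variables (X : H -> 'M[k]_N) (Y : H -> 'M[k]_N').
Hypotheses (Xl : forall c a b, X (c *: a + b) = c *: X a + X b)
  (Yl : forall c a b, Y (c *: a + b) = c *: Y a + Y b)
  (X1 : X 1 = 1%:M) (Y1 : Y 1 = 1%:M)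
  (XM : forall a b, X (a * b) = X a *m X b)
  (YM : forall a b, Y (a * b) = Y a *m Y b).

(** The tensor product of the representations X and Y. Its entries are kept
    as a function of four indices, which avoids numbering pairs of basis
    vectors. *)
Definition tensor_entry a i j p q := \sum_(x <- cop a) X x.1 i j * Y x.2 p q.

Lemma tensor_entry_bilin i j p q : bilin (fun a b => X a i j * Y b p q : k^o).
Proof. by apply: bilin_mul => c x y; rewrite ?Xl ?Yl !mxE. Qed.

Lemma tensor_entry_linear c a b i j p q :
  tensor_entry (c *: a + b) i j p q =
  c * tensor_entry a i j p q + tensor_entry b i j p q.
Proof. exact: (cop_linear_sum (tensor_entry_bilin i j p q)). Qed.

Lemma tensor_entry_teq a s i j p q :
  teq (cop a) s -> tensor_entry a i j p q = \sum_(x <- s) X x.1 i j * Y x.2 p q.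
Proof. exact: (teq_bilin (tensor_entry_bilin i j p q)). Qed.

Lemma tensor_entry1 i j p q :
  tensor_entry 1 i j p q = ((i == j) && (p == q))%:R.
Proof.
rewrite (tensor_entry_teq _ _ _ _ (cop_one (hopfP H))) big_seq1 /= X1 Y1 !mxE.
by rewrite -natrM mulnb.
Qed.

Lemma tensor_entryM a b i j p q :
  tensor_entry (a * b) i j p q =
  \sum_r \sum_s tensor_entry a i r p s * tensor_entry b r j s q.
Proof.
rewrite (tensor_entry_teq _ _ _ _ (cop_mul (hopfP H) a b)) big_allpairs_dep /=.
transitivity (\sum_(x <- cop a) \sum_(y <- cop b) \sum_r \sum_s
    (X x.1 i r * Y x.2 p s) * (X y.1 r j * Y y.2 s q)).
  apply: eq_bigr => x _; apply: eq_bigr => y _.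
  rewrite XM YM !mxE mulr_suml; apply: eq_bigr => r _.
  by rewrite mulr_sumr; apply: eq_bigr => s _; rewrite mulrACA.
pose f x y r s := (X x.1 i r * Y x.2 p s) * (X y.1 r j * Y y.2 s q).
transitivity (\sum_(x <- cop a) \sum_r \sum_(y <- cop b) \sum_s f x y r s).
  by apply: eq_bigr => x _; rewrite exchange_big.
rewrite exchange_big; apply: eq_bigr => r _.
transitivity (\sum_(x <- cop a) \sum_s \sum_(y <- cop b) f x y r s).
  by apply: eq_bigr => x _; rewrite exchange_big.
by rewrite exchange_big; apply: eq_bigr => s _; rewrite big_distrlr.
Qed.
End CopEntries.

Section Twist.
Variables (C : cartan_datum) (tw : twisting C) (U U0 : hopf Qq).
Variables (E F : 'I_(rk C) -> U) (K : rootQ C -> U).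
Variables (E0 F0 : 'I_(rk C) -> U0) (K0 : rootQ C -> U0).
Hypotheses (HU : is_Uq tw E F K) (HU0 : is_Uq (no_twist C) E0 F0 K0).
Variable g : {lrmorphism U -> U0}.
Hypothesis gP : preserves_generators g E F K E0 F0 K0.
Variables (N N' : nat) (X : U0 -> 'M[Qq]_N) (Y : U0 -> 'M[Qq]_N').
Variables (w : 'I_N -> 'rV[int]_(rk C)) (w' : 'I_N' -> 'rV[int]_(rk C)).
Hypotheses (HX : weight_rep E0 F0 K0 X w) (HY : weight_rep E0 F0 K0 Y w').

(** Conjugating the untwisted coproduct by the diagonal operator q^{(phi
    lambda, mu) / 2} yields the twisted one. Both sides are multiplicative
    in u, the exponents telescoping in a product, so it suffices to compare
    them on generators; there the change of weight by alpha_p turns the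
    exponent into the factor K_{tau_p} of the twisted coproduct. *)
Lemma twisted_tensor_entry u i j p q :
  tensor_entry (X \o g) (Y \o g) u i j p q =
  qv ^ (twist_exp tw (w i) (w' p) - twist_exp tw (w j) (w' q)) *
    tensor_entry X Y (g u) i j p q.
Proof.
have [gE gF gK] := gP.
have [Xl X1 XM XK XE XF] := HX; have [Yl Y1 YM YK YE YF] := HY.
have Xgl c a b : (X \o g) (c *: a + b) = c *: (X \o g) a + (X \o g) b.
  by rewrite /= linearP Xl.
have Ygl c a b : (Y \o g) (c *: a + b) = c *: (Y \o g) a + (Y \o g) b.
  by rewrite /= linearP Yl.
have XgM a b : (X \o g) (a * b) = (X \o g) a *m (X \o g) b.
  by rewrite /= rmorphM XM.
have YgM a b : (Y \o g) (a * b) = (Y \o g) a *m (Y \o g) b.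
  by rewrite /= rmorphM YM.
have Xg1 : (X \o g) 1 = 1%:M by rewrite /= rmorph1.
have Yg1 : (Y \o g) 1 = 1%:M by rewrite /= rmorph1.
elim/(Uq_ind HU): u i j p q => [|c u v IHu IHv|u v IHu IHv|s|s|l] i j p q.
- rewrite (tensor_entry1 Xgl Ygl) // rmorph1 (tensor_entry1 Xl Yl) //.
  by case: eqP => [->|]; case: eqP => [->|]; rewrite ?mulr0 // subrr mul1r.
- rewrite (tensor_entry_linear Xgl Ygl) linearP (tensor_entry_linear Xl Yl) IHu
  IHv.
  by rewrite mulrDr mulrCA.
- rewrite (tensor_entryM Xgl Ygl) // rmorphM (tensor_entryM Xl Yl) // mulr_sumr.
  apply: eq_bigr => r _; rewrite mulr_sumr; apply: eq_bigr => t _.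
  by rewrite IHu IHv mulrACA -expfzDr ?qv_neq0 // addrA subrK.
- rewrite (tensor_entry_teq Xgl Ygl _ _ _ _ (Uq_copE HU s)) gE.
  rewrite (tensor_entry_teq Xl Yl _ _ _ _ (Uq_copE HU0 s)) !big_cons !big_nil
    !addr0 /=.
  rewrite !gE !gK !XK !YK subr0 kpair0l expr0z mulrDr; congr (_ + _).
    (* The two summands of the coproduct match separately: a nonzero entry of
       X (E0 s) forces w i = w j + alpha_s, and similarly for Y. *)
    have [->|X0] := eqVneq (X (E0 s) i j) 0; first by rewrite !mul0r mulr0.
    case: eqP => [<-|_]; last by rewrite !mulr0n !mulr0.
    by rewrite (XE _ _ _ X0) twist_expDl addrAC subrr add0r twist_exp_rootl
      mulr1 mulrC.
  have [->|Y0] := eqVneq (Y (E0 s) p q) 0; first by rewrite !mulr0.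
  case: eqP => [<-|_]; last by rewrite !mulr0n !mul0r mulr0.
  rewrite (YE _ _ _ Y0) twist_expDr addrAC subrr add0r twist_exp_rootr mulrA.
  by rewrite !mulr1n -expfzDr ?qv_neq0 // kpairDl kpairNl addrC.
- rewrite (tensor_entry_teq Xgl Ygl _ _ _ _ (Uq_copF HU s)) gF.
  rewrite (tensor_entry_teq Xl Yl _ _ _ _ (Uq_copF HU0 s)) !big_cons !big_nil
    !addr0 /=.
  rewrite !gF !gK !XK !YK subr0 kpair0l expr0z mulrDr; congr (_ + _).
    have [->|X0] := eqVneq (X (F0 s) i j) 0; first by rewrite !mul0r mulr0.
    case: eqP => [<-|_]; last by rewrite !mulr0n !mulr0.
    rewrite (XF _ _ _ X0) twist_expDl opprD addrA subrr add0r twist_exp_rootl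
      !mulr1n.
    by rewrite kpairDl (kpairNl (tau tw s)) addrC expfzDr ?qv_neq0 // mulrCA.
  have [->|Y0] := eqVneq (Y (F0 s) p q) 0; first by rewrite !mulr0.
  case: eqP => [<-|_]; last by rewrite !mulr0n !mul0r mulr0.
  by rewrite (YF _ _ _ Y0) twist_expDr opprD addrA subrr add0r twist_exp_rootr
    opprK mul1r.
- rewrite (tensor_entry_teq Xgl Ygl _ _ _ _ (Uq_copK HU l)) gK.
  rewrite (tensor_entry_teq Xl Yl _ _ _ _ (Uq_copK HU0 l)) !big_seq1 /=
    !gK !XK !YK.
  case: eqP => [<-|_]; last by rewrite !mulr0n !mul0r mulr0.
  case: eqP => [<-|_]; last by rewrite !mulr0n !mulr0.
  by rewrite subrr expr0z mul1r.
Qed.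
End Twist.

(** * Two-cocycles supported on a torus *)

(** Let H be a Hopf algebra with a Hopf map to the group algebra of a
    group W of weights. A function h on W extends to a linear form on that
    group algebra; [T h] is its pullback to H. A bicharacter of W then pulls
    back to a 2-cocycle on H. H is assumed to be spanned by the entries of
    comatrices on which the Hopf map is diagonal; all identities are
    multilinear and are checked on such entries, where every Sweedler sum
    has one nonzero term. *)
Section TorusCocycle.
Variables (k : comNzRingType) (H : hopf k) (W : zmodType).
Variable T : (W -> k) -> H -> k.

Record comatrix (N : nat) (c : 'I_N -> 'I_N -> H) (w : 'I_N -> W) : Prop := {
  comatrix_cop : forall i j,
    teq (cop (c i j)) [seq (c i l, c l j) | l <- enum 'I_N];
  comatrix_counit : forall i j, counit (c i j) = (i == j)%:R;
  comatrix_T : forall h i j, T h (c i j) = h (w i) *+ (i == j)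
}.

Hypothesis T_slin : forall h, slin (T h).
Hypothesis T_linear : forall z h h' a,
  T (fun m => z * h m + h' m) a = z * T h a + T h' a.
Hypothesis T_one : forall h, T h 1 = h 0.
Hypothesis T_mul : forall h a b,
  T h (a * b) = T (fun m => T (fun m' => h (m + m')) b) a.
Hypothesis span : forall P : H -> Prop, P 0 ->
  (forall z a b, P a -> P b -> P (z *: a + b)) ->
  (forall N (c : 'I_N -> 'I_N -> H) w, comatrix c w -> forall i j, P (c i j)) ->
  forall a, P a.

Lemma span_lin (M : lmodType k) (f g : H -> M) : lin f -> lin g ->
  (forall N (c : 'I_N -> 'I_N -> H) w, comatrix c w ->
     forall i j, f (c i j) = g (c i j)) -> f =1 g.
Proof.
move=> fl gl fg; apply: span => //; first by rewrite (lin0 fl) (lin0 gl).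
by move=> z a b; rewrite fl gl => -> ->.
Qed.

Lemma span_bilin (M : lmodType k) (f g : H -> H -> M) : bilin f -> bilin g ->
  (forall N (c : 'I_N -> 'I_N -> H) w N' (c' : 'I_N' -> 'I_N' -> H) w',
     comatrix c w -> comatrix c' w' -> forall i j p q,
     f (c i j) (c' p q) = g (c i j) (c' p q)) -> forall a b, f a b = g a b.
Proof.
move=> [fl fr] [gl gr] fg a b.
apply: (span_lin (f := f^~ b) (g := g^~ b)) => [||N c w cw i j].
- exact: fl.
- exact: gl.
apply: span_lin => // N' c' w' cw' p q; exact: fg cw cw' _ _ _ _.
Qed.

Section Comatrix.
Variables (N : nat) (c : 'I_N -> 'I_N -> H) (w : 'I_N -> W).
Hypothesis cw : comatrix c w.

Lemma cop_comatrix (M : lmodType k) (F : H -> H -> M) i j : bilin F ->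
  \sum_(x <- cop (c i j)) F x.1 x.2 = \sum_l F (c i l) (c l j).
Proof.
by move=> Fl; rewrite (teq_bilin Fl (comatrix_cop cw i j)) big_map big_enum.
Qed.
End Comatrix.

Definition trilin (M : lmodType k) (F : H -> H -> H -> M) : Prop :=
  [/\ forall y z, lin (fun x => F x y z), forall x z, lin (fun y => F x y z) &
      forall x y, lin (F x y)].

Lemma sum_cop3 (M : lmodType k) (F : H -> H -> H -> M) a :
  \sum_(x <- cop3 a) F x.1.1 x.1.2 x.2 =
  \sum_(x <- cop a) \sum_(y <- cop x.1) F y.1 y.2 x.2.
Proof. by rewrite /cop3 big_allpairs_dep. Qed.

Lemma cop3_bilin (M : lmodType k) (F : H -> H -> H -> M) : trilin F ->
  bilin (fun a b => \sum_(y <- cop a) F y.1 y.2 b).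
Proof.
move=> [F1 F2 F3]; split=> [b|a].
- apply: (cop_linear_sum (F := fun x y => F x y b)); split=> [y|x].
  + exact: F1.
  + exact: F2.
- by apply: lin_sum => x; exact: F3.
Qed.

Lemma cop3_lin (M : lmodType k) (F : H -> H -> H -> M) : trilin F ->
  lin (fun a => \sum_(x <- cop3 a) F x.1.1 x.1.2 x.2).
Proof.
by move=> /cop3_bilin/cop_linear_sum FL c x y; rewrite !sum_cop3 FL.
Qed.

Lemma cop3_comatrix (M : lmodType k) (F : H -> H -> H -> M)
    N (c : 'I_N -> 'I_N -> H) w i j : comatrix c w -> trilin F ->
  \sum_(x <- cop3 (c i j)) F x.1.1 x.1.2 x.2 =
  \sum_l \sum_r F (c i r) (c r l) (c l j).
Proof.
move=> cw Fl; rewrite sum_cop3 (cop_comatrix cw _ _ (cop3_bilin Fl)).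
apply: eq_bigr => l _; case: Fl => F1 F2 F3.
rewrite (cop_comatrix cw (F := fun x y => F x y (c l j))) //.
by split=> x; [exact: F1|exact: F2].
Qed.

(** The pullback to H of the bilinear form of the group algebra with matrix
    g. *)
Definition torus_form (g : W -> W -> k) (a b : H) : k :=
  T (fun m => T (g m) b) a.

Lemma torus_form_slinl g b : slin (torus_form g ^~ b).
Proof. by move=> z x y; rewrite /torus_form T_slin. Qed.

Lemma torus_form_slinr g a : slin (torus_form g a).
Proof.
move=> z x y; rewrite /torus_form -T_linear; congr (T _ a); apply/funext => m.
exact: T_slin.
Qed.

Lemma torus_form_comatrix g N (c : 'I_N -> 'I_N -> H) w N'
    (c' : 'I_N' -> 'I_N' -> H) w' i j p q : comatrix c w -> comatrix c' w' ->
  torus_form g (c i j) (c' p q) = g (w i) (w' p) *+ ((i == j) && (p == q)).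
Proof.
move=> cw cw'; rewrite /torus_form (comatrix_T cw) (comatrix_T cw').
by case: (i == j).
Qed.

Lemma T_mul_comatrix h N (c : 'I_N -> 'I_N -> H) w N'
    (c' : 'I_N' -> 'I_N' -> H) w' i j p q : comatrix c w -> comatrix c' w' ->
  T h (c i j * c' p q) = h (w i + w' p) *+ ((i == j) && (p == q)).
Proof.
by move=> cw cw'; rewrite T_mul -(torus_form_comatrix (fun m m' =>
  h (m + m')) _ _ _ _ cw cw').
Qed.

Lemma bilin_sum2 (M : lmodType k) (F : H -> H -> H -> H -> M) :
  (forall y y' x', lin (fun x => F x x' y y')) ->
  (forall y y' x, lin (fun x' => F x x' y y')) ->
  (forall x x' y', lin (fun y => F x x' y y')) ->
  (forall x x' y, lin (fun y' => F x x' y y')) ->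
  bilin (fun a b => \sum_(x <- cop a) \sum_(y <- cop b) F x.1 x.2 y.1 y.2).
Proof.
move=> F1 F2 F3 F4; split=> [b|a].
- apply: (cop_linear_sum (F := fun x x' => \sum_(y <- cop b) F x x' y.1 y.2)).
  by split=> y; apply: lin_sum => i; [exact: F1|exact: F2].
- apply: lin_sum => x.
  by apply: (cop_linear_sum (F := F x.1 x.2)); split=> y; [exact: F3|exact: F4].
Qed.

Lemma sum2_comatrix (M : lmodType k) (F : H -> H -> H -> H -> M)
    N (c : 'I_N -> 'I_N -> H) w N'
    (c' : 'I_N' -> 'I_N' -> H) w' i j p q : comatrix c w -> comatrix c' w' ->
  (forall y y' x', lin (fun x => F x x' y y')) ->
  (forall y y' x, lin (fun x' => F x x' y y')) ->
  (forall x x' y', lin (fun y => F x x' y y')) ->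
  (forall x x' y, lin (fun y' => F x x' y y')) ->
  \sum_(x <- cop (c i j)) \sum_(y <- cop (c' p q)) F x.1 x.2 y.1 y.2 =
  \sum_l \sum_r F (c i l) (c l j) (c' p r) (c' r q).
Proof.
move=> cw cw' F1 F2 F3 F4.
rewrite (cop_comatrix cw
  (F := fun x x' => \sum_(y <- cop (c' p q)) F x x' y.1 y.2)); last first.
  by split=> y; apply: lin_sum => z; [exact: F1|exact: F2].
apply: eq_bigr => l _; rewrite (cop_comatrix cw' (F := F (c i l) (c l j))) //.
by split=> y; [exact: F3|exact: F4].
Qed.

Lemma torus_form_conv g g' : (forall u v, g u v * g' u v = 1) -> forall a b,
  \sum_(x <- cop a) \sum_(y <- cop b)
    torus_form g x.1 y.1 * torus_form g' x.2 y.2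
  = counit a * counit b.
Proof.
move=> gg'.
have L1 y y' x' : lin (fun x => torus_form g x y * torus_form g' x' y' : k^o).
  by apply: slin_mull; exact: torus_form_slinl.
have L2 y y' x : lin (fun x' => torus_form g x y * torus_form g' x' y' : k^o).
  by apply: slin_mulr; exact: torus_form_slinl.
have L3 x x' y' : lin (fun y => torus_form g x y * torus_form g' x' y' : k^o).
  by apply: slin_mull; exact: torus_form_slinr.
have L4 x x' y : lin (fun y' => torus_form g x y * torus_form g' x' y' : k^o).
  by apply: slin_mulr; exact: torus_form_slinr.
apply: (span_bilin (M := k^o) (bilin_sum2 L1 L2 L3 L4)).
  by apply: bilin_mul; exact: slin_counit.
move=> N c w N' c' w' cw cw' i j p q.
rewrite (sum2_comatrix _ _ _ _ cw cw' L1 L2 L3 L4).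
rewrite (comatrix_counit cw) (comatrix_counit cw').
have d a b (e e' : bool) : a *+ e * (b *+ e') = a * b *+ (e && e') :> k.
  by rewrite mulrnAr mulrnAl -mulrnA mulnb.
under eq_bigr do under eq_bigr do
  rewrite !(torus_form_comatrix _ _ _ _ _ cw cw') d.
rewrite (big_only1 i) // => [|l li _]; last first.
  by rewrite big1 // => r _; rewrite [i == l]eq_sym (negPf li).
rewrite (big_only1 p) // => [|r rp _]; last first.
  by rewrite [p == r]eq_sym (negPf rp) andbF.
by rewrite !eqxx /= gg' -natrM mulnb.
Qed.

Lemma span_trilin (M : lmodType k) (f g : H -> H -> H -> M) :
  trilin f -> trilin g ->
  (forall N (c : 'I_N -> 'I_N -> H) w N' (c' : 'I_N' -> 'I_N' -> H) w'
     N'' (c'' : 'I_N'' -> 'I_N'' -> H) w'',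
     comatrix c w -> comatrix c' w' -> comatrix c'' w'' -> forall i j p q r t,
     f (c i j) (c' p q) (c'' r t) = g (c i j) (c' p q) (c'' r t)) ->
  forall a b d, f a b d = g a b d.
Proof.
move=> [f1 f2 f3] [g1 g2 g3] fg a b d.
apply: (span_lin (f := fun a => f a b d) (g := fun a => g a b d)) =>
  [||N c w cw i j].
- exact: f1.
- exact: g1.
apply: (span_bilin (f := f (c i j)) (g := g (c i j))).
- by split=> x; [exact: f2|exact: f3].
- by split=> x; [exact: g2|exact: g3].
by move=> N' c' w' N'' c'' w'' cw' cw'' p q r t; exact: fg cw cw' cw'' _ _ _ _ _
  _.
Qed.

(** On entries both sides of the cocycle identity equal g(u, v) g(u, x)
    g(v, x), where u, v and x are the three weights. *)
Lemma torus_form_cocycle g :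
  (forall u v x, g (u + v) x = g u x * g v x) ->
  (forall u v x, g u (v + x) = g u v * g u x) -> forall a b c,
  \sum_(y <- cop b) \sum_(z <- cop c)
    torus_form g y.1 z.1 * torus_form g a (y.2 * z.2) =
  \sum_(x <- cop a) \sum_(y <- cop b)
    torus_form g x.1 y.1 * torus_form g (x.2 * y.2) c.
Proof.
move=> gl gr.
have sl := torus_form_slinl g; have sr := torus_form_slinr g.
have smr a z : slin (fun y => torus_form g a (y * z)).
  by apply: (slin_comp (@lin_mull _ H z)).
have smr' a z : slin (fun y => torus_form g a (z * y)).
  by apply: (slin_comp (@lin_mulr _ H z)).
have sml a z : slin (fun y => torus_form g (y * z) a).
  by apply: (slin_comp (g := torus_form g ^~ a) (@lin_mull _ H z)).
have sml' a z : slin (fun y => torus_form g (z * y) a).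
  by apply: (slin_comp (g := torus_form g ^~ a) (@lin_mulr _ H z)).
pose L a y y' z z' : k^o := torus_form g y z * torus_form g a (y' * z').
have L1 a z z' y' : lin (fun y => L a y y' z z') by exact: slin_mull.
have L2 a z z' y : lin (fun y' => L a y y' z z') by exact: slin_mulr.
have L3 a y y' z' : lin (fun z => L a y y' z z') by exact: slin_mull.
have L4 a y y' z : lin (fun z' => L a y y' z z') by exact: slin_mulr.
pose R c x x' y y' : k^o := torus_form g x y * torus_form g (x' * y') c.
have R1 c y y' x' : lin (fun x => R c x x' y y') by exact: slin_mull.
have R2 c y y' x : lin (fun x' => R c x x' y y') by exact: slin_mulr.
have R3 c x x' y' : lin (fun y => R c x x' y y') by exact: slin_mull.
have R4 c x x' y : lin (fun y' => R c x x' y y') by exact: slin_mulr.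
apply: (span_trilin (M := k^o)
  (f := fun a b c => \sum_(y <- cop b) \sum_(z <- cop c) L a y.1 y.2 z.1 z.2)
  (g := fun a b c => \sum_(x <- cop a) \sum_(y <- cop b) R c x.1 x.2 y.1 y.2)).
- split=> [b c|a c|a b].
  + by do 2![apply: lin_sum => ?]; exact: slin_mulr.
  + exact: (bilin_sum2 (L1 a) (L2 a) (L3 a) (L4 a)).1.
  + exact: (bilin_sum2 (L1 a) (L2 a) (L3 a) (L4 a)).2.
- split=> [b c|a c|a b].
  + exact: (bilin_sum2 (R1 c) (R2 c) (R3 c) (R4 c)).1.
  + exact: (bilin_sum2 (R1 c) (R2 c) (R3 c) (R4 c)).2.
  + by do 2![apply: lin_sum => ?]; exact: slin_mulr.
move=> N c w N' c' w' N'' c'' w'' cw cw' cw'' i j p q r t.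
rewrite (sum2_comatrix _ _ _ _ cw' cw'' (L1 _) (L2 _) (L3 _) (L4 _)).
rewrite (sum2_comatrix _ _ _ _ cw cw' (R1 _) (R2 _) (R3 _) (R4 _)).
have d a b (e e' : bool) : a *+ e * (b *+ e') = a * b *+ (e && e') :> k.
  by rewrite mulrnAr mulrnAl -mulrnA mulnb.
have TL l l' : torus_form g (c i j) (c' l q * c'' l' t) =
    g (w i) (w' l + w'' l') *+ ((i == j) && ((l == q) && (l' == t))).
  by rewrite /torus_form (comatrix_T cw) (T_mul_comatrix _ _ _ _ _ cw' cw'');
    case: (i == j).
have TR l l' : torus_form g (c l j * c' l' q) (c'' r t) =
    g (w l + w' l') (w'' r) *+ (((l == j) && (l' == q)) && (r == t)).
  by rewrite /torus_form (T_mul_comatrix _ _ _ _ _ cw cw') (comatrix_T cw'');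
    case: (_ && _).
rewrite (big_only1 p) // => [|l li _]; last first.
  rewrite big1 // => l' _; rewrite /L (torus_form_comatrix _ _ _ _ _ cw' cw'').
  by rewrite eq_sym (negPf li) mul0r.
rewrite (big_only1 r) // => [|l li _]; last first.
  rewrite /L (torus_form_comatrix _ _ _ _ _ cw' cw'').
  by rewrite [r == l]eq_sym (negPf li) andbF mul0r.
rewrite (big_only1 i) // => [|l li _]; last first.
  rewrite big1 // => l' _; rewrite /R (torus_form_comatrix _ _ _ _ _ cw cw').
  by rewrite eq_sym (negPf li) mul0r.
rewrite (big_only1 p) // => [|l li _]; last first.
  rewrite /R (torus_form_comatrix _ _ _ _ _ cw cw').
  by rewrite [p == l]eq_sym (negPf li) andbF mul0r.
rewrite /L /R TL TR (torus_form_comatrix _ _ _ _ _ cw' cw'')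
  (torus_form_comatrix _ _ _ _ _ cw cw').
rewrite !eqxx /= !mulr1n !mulrnAr -!andbA gl gr; congr (_ *+ _).
by rewrite mulrCA; congr (_ * _); rewrite mulrC.
Qed.

Lemma torus_form_normalized g :
  (forall u, g u 0 = 1) -> (forall u, g 0 u = 1) ->
  forall a, torus_form g a 1 = counit a /\ torus_form g 1 a = counit a.
Proof.
move=> g1 g2 a; split; move: a; apply: (span_lin (M := k^o)).
- exact: torus_form_slinl.
- exact: slin_counit.
- move=> N c w cw i j; rewrite /torus_form (comatrix_T cw) (comatrix_counit cw).
  by rewrite T_one g1.
- exact: torus_form_slinr.
- exact: slin_counit.
- move=> N c w cw i j.
  rewrite /torus_form T_one (comatrix_T cw) (comatrix_counit cw).
  by rewrite g2.
Qed.

Section CocycleMul.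
Variables s t : {biscalar H}.

Let Fmul (a a' a'' b b' b'' : H) : H := (s a b * t a'' b'') *: (a' * b').

Let Fmul_trilinr a a' a'' : trilin (Fmul a a' a'').
Proof.
split=> [b' b''|b b''|b b'] z x y; rewrite /Fmul.
- by rewrite linearPr mulrDl scalerDl -mulrA scalerA.
- by rewrite mulrDr -scalerAr scalerDr !scalerA mulrC.
- by rewrite linearPr mulrDr scalerDl scalerA mulrCA.
Qed.

Let Fmul_trilinl b b' b'' : trilin (fun a a' a'' => Fmul a a' a'' b b' b'').
Proof.
split=> [a' a''|a a''|a a'] z x y; rewrite /Fmul.
- by rewrite linearPl mulrDl scalerDl -mulrA scalerA.
- by rewrite mulrDl -scalerAl scalerDr !scalerA mulrC.
- by rewrite linearPl mulrDr scalerDl scalerA mulrCA.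
Qed.

Let cop3_Fmul_trilin b :
  trilin (fun a a' a'' => \sum_(y <- cop3 b) Fmul a a' a'' y.1.1 y.1.2 y.2).
Proof.
split=> [x x'|x x'|x x']; apply: lin_sum => y.
- by case: (Fmul_trilinl y.1.1 y.1.2 y.2) => L _ _; exact: L.
- by case: (Fmul_trilinl y.1.1 y.1.2 y.2) => _ L _; exact: L.
- by case: (Fmul_trilinl y.1.1 y.1.2 y.2) => _ _ L; exact: L.
Qed.

Lemma cocycle_mul_bilin : bilin (cocycle_mul s t).
Proof.
split=> [b|a].
- exact: (cop3_lin (cop3_Fmul_trilin b)).
- by apply: lin_sum => x; exact: (cop3_lin (Fmul_trilinr x.1.1 x.1.2 x.2)).
Qed.

(** On entries the deformation rescales the product, by g on the row weights
    and by g' on the column weights. *)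
Lemma cocycle_mul_comatrix g g' N (c : 'I_N -> 'I_N -> H) w N'
    (c' : 'I_N' -> 'I_N' -> H) w' i j p q : comatrix c w -> comatrix c' w' ->
  (forall a b, s a b = torus_form g a b) ->
  (forall a b, t a b = torus_form g' a b) ->
  cocycle_mul s t (c i j) (c' p q) =
  (g (w i) (w' p) * g' (w j) (w' q)) *: (c i j * c' p q).
Proof.
move=> cw cw' sg tg; rewrite /cocycle_mul.
rewrite (cop3_comatrix i j cw (cop3_Fmul_trilin (c' p q))).
under eq_bigr => l _ do under eq_bigr => r _ do
  rewrite (cop3_comatrix p q cw' (Fmul_trilinr _ _ _)).
rewrite (big_only1 j) // => [|l lj _]; last first.
  rewrite big1 // => r _; rewrite big1 // => l' _; rewrite big1 // => r' _.
  rewrite /Fmul tg (torus_form_comatrix _ _ _ _ _ cw cw').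
  by rewrite (negPf lj) mulr0n mulr0 scale0r.
rewrite (big_only1 i) // => [|r ri _]; last first.
  rewrite big1 // => l' _; rewrite big1 // => r' _.
  rewrite /Fmul sg (torus_form_comatrix _ _ _ _ _ cw cw').
  by rewrite [i == r]eq_sym (negPf ri) mulr0n mul0r scale0r.
rewrite (big_only1 q) // => [|l lj _]; last first.
  rewrite big1 // => r _.
  rewrite /Fmul tg (torus_form_comatrix _ _ _ _ _ cw cw').
  by rewrite (negPf lj) andbF mulr0n mulr0 scale0r.
rewrite (big_only1 p) // => [|r ri _]; last first.
  rewrite /Fmul sg (torus_form_comatrix _ _ _ _ _ cw cw').
  by rewrite [p == r]eq_sym (negPf ri) andbF mulr0n mul0r scale0r.
by rewrite /Fmul sg tg !(torus_form_comatrix _ _ _ _ _ cw cw') !eqxx.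
Qed.
End CocycleMul.

Lemma one_comatrix : comatrix (fun _ _ : 'I_1 => 1) (fun=> 0).
Proof.
split=> [i j M b|i j|h i j]; rewrite ?ord1 ?eqxx.
- by rewrite (cop_one (hopfP H) b) big_seq1 big_map big_enum big_ord1.
- by rewrite rmorph1.
- by rewrite T_one.
Qed.

(** The unit of H is a comatrix of size 1 and weight 0, on which normalized
    bicharacters are trivial. *)
Lemma cocycle_mul_one (s t : {biscalar H}) g g' :
  (forall a b, s a b = torus_form g a b) ->
  (forall a b, t a b = torus_form g' a b) ->
  (forall u, g u 0 = 1) -> (forall u, g' u 0 = 1) ->
  forall a, cocycle_mul s t a 1 = a.
Proof.
move=> sg tg g1 g'1; apply: span_lin => [|z x y|N c w cw i j].
- exact: (cocycle_mul_bilin s t).1.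
- by [].
have := cocycle_mul_comatrix i j ord0 ord0 cw one_comatrix sg tg.
by rewrite g1 g'1 mulr1 scale1r mulr1.
Qed.

Lemma torus_form_biscalar g :
  exists s : {biscalar H}, forall a b, s a b = torus_form g a b.
Proof.
pose FB := bilinear_isBilinear.Build k H H k *%R *%R (torus_form g)
  ((fun b => torus_form_slinl g b), (fun a => torus_form_slinr g a)).
pose G : {biscalar H} := HB.pack (torus_form g) FB.
by exists G.
Qed.
End TorusCocycle.

(** * Linear independence of the characters of the torus *)

Section Characters.
Variables (C : cartan_datum) (k : comNzRingType).
Variable sp : {rmorphism laurent -> k}.
Local Notation W := 'rV[int]_(rk C).

Lemma separating_character (v w : W) : v != w ->
  exists l : rootQ C, qv ^ kpair l v != qv ^ kpair l w.
Proof.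
move=> vw; have [i vwi] : exists i, v 0 i != w 0 i.
  apply/existsP; rewrite -negb_forall; apply: contra vw => /forallP vw.
  by apply/eqP/rowP => i; apply/eqP.
exists (alpha i); rewrite (inj_eq qv_expz_inj) !kpair_alpha.
have di0 : (dd i)%:Z != 0 by have := dd_gt0 i; case: (dd i).
by rewrite (inj_eq (mulfI di0)).
Qed.

Definition char_sum (s : seq (W * laurent)) (l : rootQ C) : Qq :=
  \sum_(p <- s) val p.2 * qv ^ kpair l p.1.

(** A function of the weight is called good when inserting it in the
    relation keeps all the sums zero. Good functions are stable under
    multiplication by chi(l0) - x, since this combines the relation at l0 +
    l and at l. A product of such factors vanishes at every weight of s
    other than m0. *)
Lemma char_sum_coef (s : seq (W * laurent)) m0 :
  (forall l, char_sum s l = 0) -> \sum_(p <- s | p.1 == m0) p.2 = 0.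
Proof.
move=> s0.
pose good (f : W -> Qq) := forall l,
  \sum_(p <- s) val p.2 * f p.1 * qv ^ kpair l p.1 = 0.
have [f [fgood fm0 ft]] : exists f, [/\ good f, f m0 != 0 &
    forall m, m \in [seq p.1 | p <- s] -> m != m0 -> f m = 0].
  elim: [seq p.1 | p <- s] => [|m t [f [fgood fm0 ft]]].
    exists (fun=> 1); split=> [l||//]; last exact: oner_neq0.
    by rewrite -[RHS](s0 l); apply: eq_bigr => p _; rewrite mulr1.
  have [mm0|mm0] := eqVneq m m0.
    exists f; split=> // m'; rewrite inE => /predU1P[->|]; last exact: ft.
    by rewrite mm0 eqxx.
  have [l0 l0P] := separating_character mm0.
  exists (fun x => f x * (qv ^ kpair l0 x - qv ^ kpair l0 m)); split.
  - move=> l; transitivity (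
      \sum_(p <- s) val p.2 * f p.1 * qv ^ kpair (l0 + l) p.1
      - qv ^ kpair l0 m * \sum_(p <- s) val p.2 * f p.1 * qv ^ kpair l p.1).
      rewrite mulr_sumr -sumrB; apply: eq_bigr => p _.
      have distr (R : comNzRingType) (x y z a u : R) :
        x * (y * (z - a)) * u = x * y * (z * u) - a * (x * y * u) by ring.
      by rewrite kpairDl expfzDr ?qv_neq0 // distr.
    by rewrite !fgood mulr0 subr0.
  - have d0 : qv ^ kpair l0 m0 - qv ^ kpair l0 m != 0.
      by rewrite subr_eq0 eq_sym.
    exact: (mulf_neq0 fm0 d0).
  - move=> m'; rewrite inE => /predU1P[->|m't] m'm0; last by rewrite ft ?mul0r.
    by rewrite subrr mulr0.
have := fgood 0; rewrite (bigID (fun p => p.1 == m0)) /=.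
rewrite [X in _ + X]big_seq_cond [X in _ + X]big1 => [|p /andP[ps pm0]];
  last first.
  by rewrite ft ?map_f // mulr0 mul0r.
rewrite addr0 => e; apply: val_inj; rewrite rmorph0 rmorph_sum.
apply: (mulIf fm0); rewrite mul0r -[RHS]e mulr_suml; apply: eq_bigr => p /eqP->.
by rewrite kpair0l expr0z mulr1.
Qed.

(** The value at h of the element s of the group algebra of the weights,
    after specialization of the coefficients. *)
Definition wsum (h : W -> k) (s : seq (W * laurent)) : k :=
  \sum_(p <- s) sp p.2 * h p.1.

Lemma char_independence (s : seq (W * laurent)) h :
  (forall l, char_sum s l = 0) -> wsum h s = 0.
Proof.
(* All occurrences of the first weight of s cancel and can be removed. *)
have [n] := ubnP (size s); elim: n s => // n IH [|[m0 r0] s] sn s0.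
  by rewrite /wsum big_nil.
rewrite /= ltnS in sn; set s' := (m0, r0) :: s in s0 *.
have c0 := char_sum_coef m0 s0.
pose s1 := [seq p <- s' | p.1 != m0].
have s1n : (size s1 < n)%N.
  rewrite /s1 /= eqxx /= size_filter.
  exact: leq_ltn_trans (count_size _ _) sn.
have -> : wsum h s' = wsum h s1.
  rewrite /wsum big_filter [LHS](bigID (fun p => p.1 == m0)) /=.
  rewrite (eq_bigr (fun p => sp p.2 * h m0)) => [|p /eqP-> //].
  by rewrite -mulr_suml -rmorph_sum c0 rmorph0 mul0r add0r.
apply: IH => // l; rewrite -[RHS](s0 l) /char_sum big_filter.
rewrite [RHS](bigID (fun p => p.1 == m0)) /=.
rewrite [X in _ = X + _](eq_bigr (fun p => val p.2 * qv ^ kpair l m0)) =>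
  [|p /eqP-> //].
by rewrite -mulr_suml -rmorph_sum c0 rmorph0 mul0r add0r.
Qed.

(** The specialization takes place after the comparison: the characters are
    independent for generic q but not at a root of unity. *)
Lemma wsum_eq (s s' : seq (W * laurent)) h :
  char_sum s =1 char_sum s' -> wsum h s = wsum h s'.
Proof.
move=> ss'; apply/eqP; rewrite -subr_eq0; apply/eqP.
have <- : wsum h (s ++ [seq (p.1, - p.2) | p <- s']) = wsum h s - wsum h s'.
  rewrite /wsum big_cat big_map -sumrN; congr (_ + _); apply: eq_bigr => p _ /=.
  by rewrite rmorphN mulNr.
apply: char_independence => l; rewrite /char_sum big_cat -/(char_sum s l) ss'.
transitivity (char_sum s' l - char_sum s' l); last exact: subrr.
congr (_ + _); rewrite big_map -sumrN; apply: eq_bigr => p _.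
by rewrite -mulNr; congr (_ * _); exact: rmorphN.
Qed.
End Characters.

(** * Matrix coefficients and their restriction to the torus *)

Section Rq.
Variables (C : cartan_datum) (tw : twisting C) (U : hopf Qq).
Variables (E F : 'I_(rk C) -> U) (K : rootQ C -> U).
Hypothesis HU : is_Uq tw E F K.
Variables (G : hopf laurent) (incl : {rmorphism G -> U}).
Hypothesis HG : is_Gamma E F K incl.
Variables (A : hopf laurent) (ev : A -> G -> laurent).
Hypothesis HA : is_Rq K incl ev.

Definition entries_of (N : nat) (rho : {linear G -> 'M[laurent]_N})
    (c : 'I_N -> 'I_N -> A) : Prop :=
  forall i j x, ev (c i j) x = rho x i j.

Lemma evP c a b x : ev (c *: a + b) x = c * ev a x + ev b x.
Proof. exact: (ev_linear_l HA x). Qed.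

Lemma ev_zero x : ev 0 x = 0.
Proof. exact: slin0 (fun c a b => evP c a b x). Qed.

Lemma ev_sum (I : Type) (r : seq I) (z : I -> laurent) (a : I -> A) x :
  ev (\sum_(i <- r) z i *: a i) x = \sum_(i <- r) z i * ev (a i) x.
Proof.
elim: r => [|i r IH]; first by rewrite !big_nil ev_zero.
by rewrite !big_cons evP IH.
Qed.

Lemma entries_ex N (rho : {linear G -> 'M[laurent]_N}) :
  admissible K incl rho -> exists c, entries_of rho c.
Proof.
move=> rhoP.
have cij i j : exists a : A, forall x, ev a x = rho x i j.
  apply/(ev_image HA); exists 1%N, (fun=> 1), (fun _ x => rho x i j).
  split=> [_|x]; last by rewrite big_ord1 mul1r.
  exists N, rho; split=> //; exists (delta_mx 0 i), (delta_mx j 0) => x.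
  by rewrite -rowE -colE !mxE.
have [c cP] := choice (fun ij => cij ij.1 ij.2).
by exists (fun i j => c (i, j)) => i j; exact: cP (i, j).
Qed.

(** A coefficient u rho v of a representation is a linear combination of the
    entries of rho, so these span. *)
Lemma Rq_ind (P : A -> Prop) : P 0 ->
  (forall z a b, P a -> P b -> P (z *: a + b)) ->
  (forall N (rho : {linear G -> 'M[laurent]_N}) c,
     admissible K incl rho -> entries_of rho c -> forall i j, P (c i j)) ->
  forall a, P a.
Proof.
move=> P0 PP Pc a.
have Psum (I : Type) (r : seq I) z (b : I -> A) :
    (forall i, P (b i)) -> P (\sum_(i <- r) z i *: b i).
  by move=> Pb; elim: r => [|i r IH]; rewrite ?big_nil // big_cons; apply: PP.
have [N [r [f [fP aE]]]] := (ev_image HA (ev a)).2 (ex_intro _ a (fun=> erefl)).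
have bi i : exists b : A, P b /\ forall x, ev b x = f i x.
  have [N' [rho [rhoP [u [v fE]]]]] := fP i.
  have [c cP] := entries_ex rhoP.
  exists (\sum_q v q 0 *: \sum_p u 0 p *: c p q); split.
    by apply: (Psum) => q; apply: (Psum) => p; exact: Pc rhoP cP _ _.
  move=> x; rewrite fE ev_sum mxE; apply: eq_bigr => q _.
  by rewrite ev_sum mxE mulrC; congr (_ * _); apply: eq_bigr => p _; rewrite cP.
have [b bP] := choice bi.
suff -> : a = \sum_i r i *: b i by apply: (Psum) => i; case: (bP i).
apply: (ev_inj HA) => x; rewrite ev_sum aE; apply: eq_bigr => i _.
by have [_ ->] := bP i.
Qed.

Lemma cop_entries N (rho : {linear G -> 'M[laurent]_N}) c :
  admissible K incl rho -> entries_of rho c ->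
  forall i j, teq (cop (c i j)) [seq (c i l, c l j) | l <- enum 'I_N].
Proof. exact: (ev_cop HA). Qed.

Lemma counit_entries N (rho : {linear G -> 'M[laurent]_N}) c :
  admissible K incl rho -> entries_of rho c ->
  forall i j, counit (c i j) = (i == j)%:R.
Proof. by move=> [rho1 _ _] cP i j; rewrite (ev_counit HA) cP rho1 mxE. Qed.

Lemma admissible_wt N (rho : {linear G -> 'M[laurent]_N}) :
  admissible K incl rho -> exists w : 'I_N -> 'rV[int]_(rk C),
    weight_rep E F K (ext_rep HU HG rho) w.
Proof.
move=> [rho1 rhoM [m [mK _]]]; exists (eigen_wt m).
exact: (ext_rep_weight_rep HU HG rho1 rhoM mK).
Qed.

(** The family s lists the weights and the coefficients of the restriction
    of the function [a] to the torus. *)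
Definition torus_expansion (a : A) (s : seq ('rV[int]_(rk C) * laurent)) :
    Prop :=
  forall l x, incl x = K l -> val (ev a x) = char_sum s l.

Lemma torus_expansion_entries N (rho : {linear G -> 'M[laurent]_N}) c w i j :
  entries_of rho c -> weight_rep E F K (ext_rep HU HG rho) w ->
  torus_expansion (c i j) (if i == j then [:: (w i, 1)] else [::]).
Proof.
move=> cP wP l x xE.
have := wrepK wP l i j; rewrite -xE ext_rep_incl mxE -cP => ->.
rewrite /char_sum; case: (i == j); last by rewrite big_nil.
rewrite big_seq1; symmetry; exact: mul1r.
Qed.

Lemma torus_expansionP z a b s t :
  torus_expansion a s -> torus_expansion b t ->
  torus_expansion (z *: a + b) ([seq (p.1, z * p.2) | p <- s] ++ t).
Proof.
move=> sP tP l x xE; rewrite evP /char_sum big_cat -/(char_sum t l) big_map.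
rewrite lvalD lvalM (sP _ _ xE) (tP _ _ xE); congr (_ + _).
rewrite /char_sum mulr_sumr; apply: eq_bigr => p _.
by rewrite mulrA; congr (_ * _); symmetry; exact: lvalM.
Qed.

Lemma torus_expansion_ex a : exists s, torus_expansion a s.
Proof.
elim/Rq_ind: a => [|z a b [s sP] [t tP]|N rho c rhoP cP i j].
- by exists [::] => l x _; rewrite ev_zero /char_sum big_nil rmorph0.
- by eexists; exact: torus_expansionP sP tP.
- have [w wP] := admissible_wt rhoP.
  by eexists; exact: torus_expansion_entries cP wP.
Qed.

Lemma torus_expansion_sum a s t :
  torus_expansion a s -> torus_expansion a t -> char_sum s =1 char_sum t.
Proof.
move=> sP tP l; have [x xE] := in_Gamma_ex HG (in_Gamma_K HU l).
by rewrite -(sP _ _ xE) (tP _ _ xE).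
Qed.

(** A group-like invertible element has counit 1. *)
Lemma ev1_K l x : incl x = K l -> ev 1 x = 1.
Proof.
move=> xE; rewrite (ev_one HA); apply: val_inj.
rewrite -[LHS](incl_counit HG) xE.
have uK : counit (K l) * counit (K (- l)) = 1.
  by rewrite -rmorphM -(K_add (Uq_rel HU)) subrr (K_zero (Uq_rel HU)) rmorph1.
have bl : bilin (fun a b : U => counit a *: b).
  split=> [y c a b|y c a b]; first by rewrite linearP scalerDl scalerA.
  by rewrite scalerDr !scalerA mulrC.
have := teq_bilin bl (Uq_copK HU l).
rewrite (counit_left (hopfP U)) big_seq1 /= => /(congr1 counit).
rewrite linearZ /= => e.
have u0 : counit (K l) != 0.
  by apply/eqP => u0; move/eqP: uK; rewrite u0 mul0r eq_sym oner_eq0.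
by apply: (mulfI u0); rewrite -e mulr1.
Qed.

Lemma torus_expansion_one : torus_expansion 1 [:: (0, 1)].
Proof.
move=> l x xE; rewrite (ev1_K xE) /char_sum big_seq1 kpair0r expr0z.
by rewrite mulr1.
Qed.

Section Products.
Variables (N : nat) (rho : {linear G -> 'M[laurent]_N}) (c : 'I_N -> 'I_N -> A).
Variables (N' : nat) (rho' : {linear G -> 'M[laurent]_N'}).
Variable (c' : 'I_N' -> 'I_N' -> A).
Hypotheses (cP : entries_of rho c) (cP' : entries_of rho' c').

Local Notation X := (ext_rep HU HG rho).
Local Notation Y := (ext_rep HU HG rho').

(** The product of functions is dual to the coproduct of Gamma, which
    becomes computable on generators once both representations are extended. *)
Lemma ev_mul_entries i j p q x :
  val (ev (c i j * c' p q) x) = tensor_entry X Y (incl x) i j p q.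
Proof.
rewrite (tensor_entry_teq (ext_rep_linear HU HG rho) (ext_rep_linear HU HG rho')
  _ _ _ _   (incl_cop HG x)) big_map (ev_mul HA) rmorph_sum.
apply: eq_bigr => y _; rewrite cP cP' !ext_rep_incl !mxE; exact: lvalM.
Qed.

Lemma torus_expansion_mul w w' i j p q :
  weight_rep E F K X w -> weight_rep E F K Y w' ->
  torus_expansion (c i j * c' p q)
    (if (i == j) && (p == q) then [:: (w i + w' p, 1)] else [::]).
Proof.
move=> wP wP' l x xE; rewrite ev_mul_entries xE.
rewrite (tensor_entry_teq (ext_rep_linear HU HG rho) (ext_rep_linear HU HG rho')
  _ _ _ _   (Uq_copK HU l)) big_seq1 (wrepK wP) (wrepK wP') /char_sum.
case: (i == j); last by rewrite big_nil mul0r.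
case: (p == q); last by rewrite big_nil mulr0.
rewrite big_seq1 kpairDr expfzDr ?qv_neq0 //; symmetry; exact: mul1r.
Qed.
End Products.
End Rq.

(** * Base change *)

(** A copy of M, so that it can carry the structure of R-module obtained
    through sp. *)
Definition restr_scalars (k : comNzRingType) (sp : {rmorphism laurent -> k})
  (M : lmodType k) : Type := M.

Section RestrictScalars.
Variables (k : comNzRingType) (sp : {rmorphism laurent -> k}) (M : lmodType k).
Local Notation restr_scalars := (restr_scalars sp M).

HB.instance Definition _ := GRing.Zmodule.copy restr_scalars M.

Definition restr_scale (r : laurent) (m : restr_scalars) : restr_scalars :=
  sp r *: (m : M).

Lemma restr_scaleA a b v :
  restr_scale a (restr_scale b v) = restr_scale (a * b) v.
Proof. by rewrite /restr_scale scalerA rmorphM. Qed.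
Lemma restr_scale1 : left_id 1 restr_scale.
Proof. by move=> v; rewrite /restr_scale rmorph1 scale1r. Qed.
Lemma restr_scaleDr : right_distributive restr_scale +%R.
Proof. by move=> a u v; exact: scalerDr. Qed.
Lemma restr_scaleDl v : {morph restr_scale^~ v : a b / a + b}.
Proof. by move=> a b; rewrite /restr_scale rmorphD scalerDl. Qed.

HB.instance Definition _ := GRing.Zmodule_isLmodule.Build laurent restr_scalars
  restr_scaleA restr_scale1 restr_scaleDr restr_scaleDl.
End RestrictScalars.

Section BaseChange.
Variables (k : comNzRingType) (sp : {rmorphism laurent -> k}).
Variables (A : hopf laurent) (O : hopf k) (iota : {rmorphism A -> O}).
Hypothesis HO : is_base_change sp iota.

Lemma iota_semilinear z a b : iota (z *: a + b) = sp z *: iota a + iota b.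
Proof. by rewrite rmorphD (iota_scale HO). Qed.

(** A k-bilinear map on O restricts to an R-bilinear map on A once its target
    is regarded as an R-module. *)
Lemma teq_iota (s t : seq (A * A)) : teq s t ->
  teq [seq (iota x.1, iota x.2) | x <- s] [seq (iota x.1, iota x.2) | x <- t].
Proof.
move=> st M b; rewrite !big_map /=.
pose F (x y : A) : restr_scalars sp M := b (iota x) (iota y).
have Fl : bilin F.
  split=> [y z x x'|x z y y']; rewrite /F iota_semilinear.
  - exact: linearPl.
  - exact: linearPr.
exact: (teq_bilin Fl st).
Qed.

Lemma extend_iota (M : lmodType k) (g : A -> M) :
  (forall r a b, g (r *: a + b) = sp r *: g a + g b) ->
  exists2 h : {linear O -> M}, (forall a, h (iota a) = g a) &
    forall h' : {linear O -> M}, (forall a, h' (iota a) = g a) -> h' =1 h.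
Proof.
move=> gP.
have g0 : g 0 = 0.
  have := gP (-1) 0 0; rewrite scaler0 addr0 rmorphN1 scaleN1r.
  by move=> ->; rewrite addNr.
have gB : zmod_morphism g.
  by move=> a b; rewrite -[a - b]addrC -scaleN1r gP rmorphN1 scaleN1r addrC.
pose gadd : {additive A -> M} :=
  HB.pack g (GRing.isZmodMorphism.Build A M g gB).
apply: (iota_univ HO (g := gadd)) => r a.
by rewrite -[r *: a]addr0 /= gP g0 addr0.
Qed.

(** As for [Uq_ind]: the universal property gives a linear map into the
    submodule defined by P, which followed by the inclusion fixes the image
    of A, hence is the identity. *)
Lemma base_change_ind (P : O -> Prop) : P 0 ->
  (forall z x y, P x -> P y -> P (z *: x + y)) ->
  (forall a, P (iota a)) -> forall x, P x.
Proof.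
move=> P0 PP Pi x.
have [V [i [iinj iP iex]]] := submodule_type P0 PP.
have [g gE] := choice (fun a => iex _ (Pi a)).
have gP r a b : g (r *: a + b) = sp r *: g a + g b.
  by apply: iinj; rewrite linearP !gE iota_semilinear.
have [h hE _] := extend_iota gP.
have [j _ jU] := extend_iota iota_semilinear.
have /= := jU (i \o h : {linear O -> O}) _ x.
rewrite -(jU (idfun : {linear O -> O})) //= => <- // a.
by rewrite /= hE gE.
Qed.
End BaseChange.

Section Torus.
Variables (C : cartan_datum) (tw : twisting C) (U : hopf Qq).
Variables (E F : 'I_(rk C) -> U) (K : rootQ C -> U).
Hypothesis HU : is_Uq tw E F K.
Variables (G : hopf laurent) (incl : {rmorphism G -> U}).
Hypothesis HG : is_Gamma E F K incl.
Variables (A : hopf laurent) (ev : A -> G -> laurent).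
Hypothesis HA : is_Rq K incl ev.
Variables (k : comNzRingType) (sp : {rmorphism laurent -> k}).
Variables (O : hopf k) (iota : {rmorphism A -> O}).
Hypothesis HO : is_base_change sp iota.
Local Notation W := 'rV[int]_(rk C).

Lemma base_change_entries_ind (P : O -> Prop) : P 0 ->
  (forall z x y, P x -> P y -> P (z *: x + y)) ->
  (forall N (rho : {linear G -> 'M[laurent]_N}) c,
     admissible K incl rho -> entries_of ev rho c ->
     forall i j, P (iota (c i j))) ->
  forall x, P x.
Proof.
move=> P0 PP Pc; apply: (base_change_ind HO) => // a.
elim/(Rq_ind HA): a => [|z a b Pa Pb|N rho c rhoP cP i j].
- by rewrite rmorph0.
- by rewrite (iota_semilinear HO); exact: PP.
- exact: Pc rhoP cP _ _.
Qed.

Lemma cop_iota_entries N (rho : {linear G -> 'M[laurent]_N}) c i j :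
  admissible K incl rho -> entries_of ev rho c ->
  teq (cop (iota (c i j))) [seq (iota (c i l), iota (c l j)) | l <- enum 'I_N].
Proof.
move=> rhoP cP M b; rewrite (iota_cop HO (c i j) b).
have := teq_iota HO (cop_entries HA rhoP cP i j) b => ->.
by rewrite !big_map.
Qed.

(** Restriction to the torus, read as a linear form on the base change. It
    is well defined over R by the independence of characters, and is then
    extended. *)
Lemma torus_functional_ex (h : W -> k) : exists f : O -> k, slin f /\
  forall a s, torus_expansion K incl ev a s -> f (iota a) = wsum sp h s.
Proof.
have sex a := torus_expansion_ex HU HG HA a.
pose g a : k^o := wsum sp h (projT1 (cid (sex a))).
have gE a s : torus_expansion K incl ev a s -> g a = wsum sp h s.
  move=> sP; apply: wsum_eq; rewrite /g; case: cid => t tP /=.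
  exact: (torus_expansion_sum HU HG tP sP).
have gP r a b : g (r *: a + b) = sp r *: g a + g b.
  have [s sP] := sex a; have [t tP] := sex b.
  rewrite (gE _ _ sP) (gE _ _ tP) (gE _ _ (torus_expansionP HA r sP tP)).
  rewrite /wsum big_cat big_map; congr (_ + _); rewrite scaler_sumr.
  by apply: eq_bigr => p _; rewrite rmorphM -mulrA.
have [f fE _] := extend_iota HO gP.
exists f; split=> [z x y|a s sP]; first exact: linearP.
by rewrite fE; exact: gE.
Qed.

Definition torus_functional (h : W -> k) : O -> k :=
  projT1 (cid (torus_functional_ex h)).
Local Notation T := torus_functional.

Lemma torus_functional_slin h : slin (T h).
Proof. by rewrite /T; case: cid => f []. Qed.

Lemma torus_functional_iota h a s :
  torus_expansion K incl ev a s -> T h (iota a) = wsum sp h s.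
Proof. by rewrite /T; case: cid => f [fl fE] /=; exact: fE. Qed.

Lemma torus_functional_linear z h h' x :
  T (fun m => z * h m + h' m) x = z * T h x + T h' x.
Proof.
elim/(base_change_ind HO): x => [|r x y IHx IHy|a].
- by rewrite !(slin0 (torus_functional_slin _)) mulr0 addr0.
- rewrite !torus_functional_slin IHx IHy !mulrDr addrACA; congr (_ + _ + _).
  exact: mulrCA.
- have [s sP] := torus_expansion_ex HU HG HA a.
  rewrite !(torus_functional_iota _ sP) /wsum mulr_sumr -big_split.
  by apply: eq_bigr => p _; rewrite mulrDr mulrCA.
Qed.

Lemma torus_functional_one h : T h 1 = h 0.
Proof.
rewrite -(rmorph1 iota) (torus_functional_iota _ (torus_expansion_one HU HG
  HA)).
by rewrite /wsum big_seq1 rmorph1 mul1r.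
Qed.

Lemma torus_functional_entries N (rho : {linear G -> 'M[laurent]_N}) c w h i j :
  entries_of ev rho c -> weight_rep E F K (ext_rep HU HG rho) w ->
  T h (iota (c i j)) = h (w i) *+ (i == j).
Proof.
move=> cP wP.
rewrite (torus_functional_iota _ (torus_expansion_entries i j cP wP)) /wsum.
case: (i == j); last by rewrite big_nil.
by rewrite big_seq1 rmorph1 mul1r.
Qed.

Lemma torus_functional_mul h x y :
  T h (x * y) = T (fun m => T (fun m' => h (m + m')) y) x.
Proof.
have T0 f : T f 0 = 0 := slin0 (torus_functional_slin f).
elim/base_change_entries_ind: x y => [|r x x' IHx IHx'|N rho c rhoP cP i j] y.
- by rewrite mul0r !T0.
- by rewrite mulrDl -scalerAl !torus_functional_slin IHx IHx'.
have [w wP] := admissible_wt HU HG rhoP.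
rewrite (torus_functional_entries _ _ _ cP wP).
elim/base_change_entries_ind: y => [|r y y' IHy IHy'|N' rho' c' rhoP' cP' p q].
- by rewrite mulr0 !T0 mul0rn.
- rewrite mulrDr -scalerAr !torus_functional_slin IHy IHy'.
  by rewrite mulrnDl mulrnAr.
have [w' wP'] := admissible_wt HU HG rhoP'.
rewrite (torus_functional_entries _ _ _ cP' wP') -rmorphM.
rewrite (torus_functional_iota _
  (torus_expansion_mul HA cP cP' i j p q wP wP')) /wsum.
case: (i == j); last by rewrite big_nil.
case: (p == q); last by rewrite big_nil.
by rewrite big_seq1 rmorph1 mul1r.
Qed.

(** The entries of a representation form a comatrix on which restriction to
    the torus is diagonal, because the torus acts diagonally in the standard
    basis. *)
Lemma iota_comatrix N (rho : {linear G -> 'M[laurent]_N}) c w :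
  admissible K incl rho -> entries_of ev rho c ->
  weight_rep E F K (ext_rep HU HG rho) w ->
  comatrix T (fun i j => iota (c i j)) w.
Proof.
move=> rhoP cP wP; split=> [i j|i j|h i j].
- exact: cop_iota_entries rhoP cP.
- rewrite (iota_counit HO) (counit_entries HA rhoP cP).
  by case: (i == j); rewrite ?rmorph1 ?rmorph0.
- exact: torus_functional_entries cP wP.
Qed.

Lemma comatrix_span (P : O -> Prop) : P 0 ->
  (forall z a b, P a -> P b -> P (z *: a + b)) ->
  (forall N (c : 'I_N -> 'I_N -> O) w, comatrix T c w -> forall i j,
    P (c i j)) ->
  forall a, P a.
Proof.
move=> P0 PP Pc; apply: base_change_entries_ind => // N rho c rhoP cP i j.
have [w wP] := admissible_wt HU HG rhoP.
exact: Pc (iota_comatrix rhoP cP wP) i j.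
Qed.
End Torus.

(** * Comparing the twisted and the untwisted function algebras *)

(** An isomorphism of the enveloping algebras respecting the generators
    identifies the forms Gamma, hence their admissible representations,
    hence the spaces of functions spanned by matrix coefficients. *)
Section Transport.
Variables (C : cartan_datum) (U U' : hopf Qq).
Variables (E F : 'I_(rk C) -> U) (K : rootQ C -> U).
Variables (E' F' : 'I_(rk C) -> U') (K' : rootQ C -> U').
Variables (g : {lrmorphism U -> U'}).
Hypothesis gP : preserves_generators g E F K E' F' K'.
Variables (G G' : hopf laurent) (incl : {rmorphism G -> U}).
Variables (incl' : {rmorphism G' -> U'}).
Hypotheses (HG : is_Gamma E F K incl) (HG' : is_Gamma E' F' K' incl').

Lemma map_K_binom i t : g (K_binom K i t) = K_binom K' i t.
Proof.
have [_ _ gK] := gP; rewrite rmorph_prod; apply: eq_bigr => s _ /=.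
by rewrite linearZ rmorphB /= linearZ rmorph1 /= gK.
Qed.

Lemma in_Gamma_map u : in_Gamma E F K u -> in_Gamma E' F' K' (g u).
Proof.
have [gE gF gK] := gP.
elim=> [i|i t t0|i t t0|i t t0||r x _ IH|x y _ IHx _ IHy|x y _ IHx _ IHy].
- by rewrite gK; exact: Gamma_Kinv.
- by rewrite map_K_binom; exact: Gamma_Kbinom.
- by rewrite linearZ rmorphXn /= gE; exact: (@Gamma_E _ _ E' F' K').
- by rewrite linearZ rmorphXn /= gF; exact: (@Gamma_F _ _ E' F' K').
- by rewrite rmorph1; exact: Gamma_one.
- by rewrite linearZ; exact: Gamma_scale.
- by rewrite rmorphD; exact: Gamma_add.
- by rewrite rmorphM; exact: Gamma_mul.
Qed.

Lemma Gamma_map : exists th : {linear G -> G'},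
  forall x, incl' (th x) = g (incl x).
Proof.
have thex x : exists y, incl' y = g (incl x).
  by apply/(incl_image HG')/in_Gamma_map/(incl_image HG); exists x.
have [th thE] := choice thex.
have thl : lin th.
  move=> r x y; apply: (incl_inj HG'); rewrite thE rmorphD (incl_scale HG)
    linearP.
  by rewrite rmorphD (incl_scale HG') !thE.
by have [th' th'E] := lin_bundle thl; exists th' => x; rewrite th'E.
Qed.

Variable th : {linear G -> G'}.
Hypothesis thE : forall x, incl' (th x) = g (incl x).

Lemma Gamma_map1 : th 1 = 1.
Proof. by apply: (incl_inj HG'); rewrite thE !rmorph1. Qed.

Lemma Gamma_mapM x y : th (x * y) = th x * th y.
Proof. by apply: (incl_inj HG'); rewrite thE !rmorphM /= !thE. Qed.

Lemma admissible_pull N (rho : {linear G' -> 'M[laurent]_N}) :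
  admissible K' incl' rho ->
  admissible K incl (rho \o th : {linear G -> 'M[laurent]_N}).
Proof.
have [_ _ gK] := gP.
move=> [rho1 rhoM [m [mK mB]]]; split=> [|x y|].
- by rewrite /= Gamma_map1.
- by rewrite /= Gamma_mapM rhoM.
exists m; split=> [i x xE|i t x xE] a b.
- by apply: mK; rewrite thE xE gK.
- by apply: mB; rewrite thE xE map_K_binom.
Qed.

Variables (A A' : hopf laurent) (ev : A -> G -> laurent).
Variable (ev' : A' -> G' -> laurent).
Hypotheses (HA : is_Rq K incl ev) (HA' : is_Rq K' incl' ev').

Lemma Rq_pull :
  exists f : {linear A' -> A}, forall a x, ev (f a) x = ev' a (th x).
Proof.
have fex a : exists b : A, forall x, ev b x = ev' a (th x).
  apply/(ev_image HA).
  have [N [r [c [cP aE]]]] := (ev_image HA' (ev' a)).2 (ex_intro _ a (fun=>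
    erefl)).
  exists N, r, (fun i x => c i (th x)); split=> [i|x]; last exact: aE.
  have [N' [rho [rhoP [u [v cE]]]]] := cP i.
  exists N', (rho \o th : {linear G -> 'M[laurent]_N'}).
  split; first exact: admissible_pull.
  by exists u, v => x; rewrite cE.
have [f fE] := choice fex.
have fl : lin f.
  move=> r a b; apply: (ev_inj HA) => x.
  by rewrite fE (evP HA) (evP HA') !fE.
by have [f' f'E] := lin_bundle fl; exists f' => a x; rewrite f'E.
Qed.
End Transport.

Lemma base_change_map (k : comNzRingType) (sp : {rmorphism laurent -> k})
    (A A' : hopf laurent) (O O' : hopf k) (iota : {rmorphism A -> O})
    (iota' : {rmorphism A' -> O'}) (f : {linear A -> A'}) :
  is_base_change sp iota -> is_base_change sp iota' ->
  exists fO : {linear O -> O'}, forall a, fO (iota a) = iota' (f a).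
Proof.
move=> HO HO'.
have [] := @extend_iota _ sp _ _ _ HO O' (fun a => iota' (f a)).
  by move=> r a b; rewrite linearP (iota_semilinear HO').
by move=> h hE _; exists h.
Qed.

(** Index 1 refers to the twisted objects, index 0 to the untwisted ones. *)
Section Main.
Variables (C : cartan_datum) (tw : twisting C).
Variables (k : comNzRingType) (sp : {rmorphism laurent -> k}).

Variables (U1 : hopf Qq) (E1 F1 : 'I_(rk C) -> U1) (K1 : rootQ C -> U1).
Variables (G1 : hopf laurent) (incl1 : {rmorphism G1 -> U1}).
Variables (A1 : hopf laurent) (ev1 : A1 -> G1 -> laurent).
Variables (O1 : hopf k) (iota1 : {rmorphism A1 -> O1}).
Hypotheses (HU1 : is_Uq tw E1 F1 K1) (HG1 : is_Gamma E1 F1 K1 incl1).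
Hypotheses (HA1 : is_Rq K1 incl1 ev1) (HO1 : is_base_change sp iota1).

Variables (U0 : hopf Qq) (E0 F0 : 'I_(rk C) -> U0) (K0 : rootQ C -> U0).
Variables (G0 : hopf laurent) (incl0 : {rmorphism G0 -> U0}).
Variables (A0 : hopf laurent) (ev0 : A0 -> G0 -> laurent).
Variables (O0 : hopf k) (iota0 : {rmorphism A0 -> O0}).
Hypotheses (HU0 : is_Uq (no_twist C) E0 F0 K0) (HG0 : is_Gamma E0 F0 K0 incl0).
Hypotheses (HA0 : is_Rq K0 incl0 ev0) (HO0 : is_base_change sp iota0).

Variables (g : {lrmorphism U1 -> U0}) (h : {lrmorphism U0 -> U1}).
Hypotheses (gP : preserves_generators g E1 F1 K1 E0 F0 K0).
Hypotheses (hP : preserves_generators h E0 F0 K0 E1 F1 K1).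
Hypotheses (gK : cancel g h) (hK : cancel h g).

Variables (thg : {linear G1 -> G0}) (thh : {linear G0 -> G1}).
Hypotheses (thgE : forall x, incl0 (thg x) = g (incl1 x)).
Hypotheses (thhE : forall y, incl1 (thh y) = h (incl0 y)).

Variables (fA : {linear A1 -> A0}) (fA' : {linear A0 -> A1}).
Hypotheses (fAE : forall a y, ev0 (fA a) y = ev1 a (thh y)).
Hypotheses (fAE' : forall a x, ev1 (fA' a) x = ev0 a (thg x)).

Variables (f : {linear O1 -> O0}) (f' : {linear O0 -> O1}).
Hypotheses (fE : forall a, f (iota1 a) = iota0 (fA a)).
Hypotheses (fE' : forall a, f' (iota0 a) = iota1 (fA' a)).

Lemma Gamma_isoK : cancel thg thh.
Proof. by move=> x; apply: (incl_inj HG1); rewrite thhE thgE gK. Qed.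

Lemma Gamma_isoK' : cancel thh thg.
Proof. by move=> x; apply: (incl_inj HG0); rewrite thgE thhE hK. Qed.

Lemma Rq_isoK : cancel fA fA'.
Proof. by move=> a; apply: (ev_inj HA1) => x; rewrite fAE' fAE Gamma_isoK. Qed.

Lemma Rq_isoK' : cancel fA' fA.
Proof. by move=> a; apply: (ev_inj HA0) => x; rewrite fAE fAE' Gamma_isoK'. Qed.

Lemma Oq_iso_bij : bijective f.
Proof.
exists f'.
- apply: (base_change_ind HO1) => [|z x y IHx IHy|a].
  + by rewrite !linear0.
  + by rewrite !linearP IHx IHy.
  + by rewrite fE fE' Rq_isoK.
- apply: (base_change_ind HO0) => [|z x y IHx IHy|a].
  + by rewrite !linear0.
  + by rewrite !linearP IHx IHy.
  + by rewrite fE' fE Rq_isoK'.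
Qed.

Section Entries.
Variables (N : nat) (rho1 : {linear G1 -> 'M[laurent]_N}).
Variable (c : 'I_N -> 'I_N -> A1).
Hypotheses (rho1P : admissible K1 incl1 rho1) (cP : entries_of ev1 rho1 c).

Let rho0 : {linear G0 -> 'M[laurent]_N} := rho1 \o thh.

Lemma admissible_transported : admissible K0 incl0 rho0.
Proof. exact: (admissible_pull hP HG1 thhE rho1P). Qed.

Lemma entries_transported : entries_of ev0 rho0 (fun i j => fA (c i j)).
Proof. by move=> i j x; rewrite fAE cP. Qed.

(** The same fraction computes both extensions. *)
Lemma ext_rep_pull u : ext_rep HU0 HG0 rho0 (g u) = ext_rep HU1 HG1 rho1 u.
Proof.
have [r [x [r0 ru]]] := Gamma_frac HU1 HG1 u.
have gru : val r *: g u = incl0 (thg x) by rewrite thgE -ru linearZ.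
by rewrite (ext_repE _ _ _ r0 ru) (ext_repE _ _ _ r0 gru) /= Gamma_isoK.
Qed.
End Entries.

(** The twisted and the untwisted products of two entries are proportional.
    This is the dual form of [twisted_tensor_entry]. *)
Lemma Rq_iso_mul_entries N (rho : {linear G1 -> 'M[laurent]_N}) c
    N' (rho' : {linear G1 -> 'M[laurent]_N'}) c' w w' i j p q :
  admissible K1 incl1 rho -> entries_of ev1 rho c ->
  admissible K1 incl1 rho' -> entries_of ev1 rho' c' ->
  weight_rep E0 F0 K0 (ext_rep HU0 HG0 (rho \o thh)) w ->
  weight_rep E0 F0 K0 (ext_rep HU0 HG0 (rho' \o thh)) w' ->
  fA (c i j * c' p q) =
  lq (twist_exp tw (w i) (w' p) - twist_exp tw (w j) (w' q)) *:
    (fA (c i j) * fA (c' p q)).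
Proof.
move=> rhoP cP rhoP' cP' wP wP'.
apply: (ev_inj HA0) => y; apply: val_inj.
rewrite -[_ *: _ in RHS]addr0 (evP HA0) (ev_zero HA0) addr0 fAE lvalM.
rewrite (ev_mul_entries HU1 HG1 HA1 cP cP').
have cP0 := entries_transported cP.
have cP0' := entries_transported cP'.
rewrite (ev_mul_entries HU0 HG0 HA0 cP0 cP0') thhE.
have := twisted_tensor_entry HU1 HU0 gP wP wP' (h (incl0 y)) i j p q.
rewrite hK => <-; apply: eq_bigr => z _ /=.
by rewrite !ext_rep_pull.
Qed.

Local Notation T0 := (torus_functional HU0 HG0 HA0 HO0).

(** The bicharacter q^{(phi u, v) / 2} specialized along [sp], and
    its inverse. *)
Definition bichar (u v : 'rV[int]_(rk C)) : k := sp (lq (twist_exp tw u v)).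
Definition bicharV (u v : 'rV[int]_(rk C)) : k := sp (lq (- twist_exp tw u v)).

Lemma bichar_mulV u v : bichar u v * bicharV u v = 1.
Proof. by rewrite -rmorphM -lqD subrr lq0 rmorph1. Qed.

Let T0l := torus_functional_slin HU0 HG0 HA0 HO0.
Let T0r := torus_functional_linear HU0 HG0 HA0 HO0.
Let T01 := torus_functional_one HU0 HG0 HA0 HO0.
Let T0M := torus_functional_mul HU0 HG0 HA0 HO0.
Let T0s := comatrix_span (HU := HU0) (HG := HG0) (HA := HA0) (HO := HO0).

(** Both sides are bilinear, and on entries both multiply the untwisted
    product by the same ratio of powers of q: on the left by
    [Rq_iso_mul_entries], on the right because the cocycle sees only the
    weights of the rows and its inverse those of the columns. *)
Lemma Oq_iso_mul (s t : {biscalar O0}) :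
  (forall a b, s a b = torus_form T0 bichar a b) ->
  (forall a b, t a b = torus_form T0 bicharV a b) ->
  forall a b, f (a * b) = cocycle_mul s t (f a) (f b).
Proof.
move=> sE tE a b.
have [cml cmr] := cocycle_mul_bilin s t.
have cm0l y : cocycle_mul s t 0 y = 0 := lin0 (cml y).
have cm0r x : cocycle_mul s t x 0 = 0 := lin0 (cmr x).
elim/(base_change_entries_ind HA1 HO1): a b => [|z x x' IHx IHx'|N rho c rhoP cP
  i j] b.
- by rewrite mul0r !linear0 cm0l.
- by rewrite mulrDl -scalerAl !linearP cml IHx IHx'.
elim/(base_change_entries_ind HA1 HO1): b => [|z y y' IHy IHy'|N' rho' c' rhoP'
  cP' p q].
- by rewrite mulr0 !linear0 cm0r.
- by rewrite mulrDr -scalerAr !linearP cmr IHy IHy'.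
have [w wP] := admissible_wt HU0 HG0 (admissible_transported rhoP).
have [w' wP'] := admissible_wt HU0 HG0 (admissible_transported rhoP').
have cw := iota_comatrix HA0 HO0 (admissible_transported rhoP)
  (entries_transported cP) wP.
have cw' := iota_comatrix HA0 HO0 (admissible_transported rhoP')
  (entries_transported cP') wP'.
rewrite -rmorphM !fE (Rq_iso_mul_entries i j p q rhoP cP rhoP' cP' wP wP').
rewrite (cocycle_mul_comatrix i j p q cw cw' sE tE).
by rewrite (iota_scale HO0) rmorphM lqD rmorphM.
Qed.

Lemma Oq_iso_cop a : teq (cop (f a)) [seq (f x.1, f x.2) | x <- cop a].
Proof.
move=> M b; rewrite big_map /=.
have bl : bilin b.
  by split=> [y z x x'|x z y y']; [exact: linearPl|exact: linearPr].
have fbl : bilin (fun x y => b (f x) (f y)).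
  by split=> [y z x x'|x z y y']; rewrite linearP;
    [exact: linearPl|exact: linearPr].
have L1 := cop_linear_sum bl; have L2 := cop_linear_sum fbl.
elim/(base_change_entries_ind HA1 HO1): a => [|z x y IHx IHy|N rho c rhoP cP i
  j].
- by rewrite linear0 (lin0 L1) (lin0 L2).
- by rewrite linearP L1 L2 IHx IHy.
rewrite fE (teq_bilin bl (cop_iota_entries HA0 HO0 i j (admissible_transported
  rhoP) (entries_transported cP))).
rewrite (teq_bilin fbl (cop_iota_entries HA1 HO1 i j rhoP cP)) !big_map.
by apply: eq_bigr => l _ /=; rewrite !fE.
Qed.

Lemma Oq_iso_counit a : counit (f a) = counit a.
Proof.
have counitP (H : hopf k) z (x y : H) :
  counit (z *: x + y) = z * counit x + counit y by exact: slin_counit.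
elim/(base_change_ind HO1): a => [|z x y IHx IHy|a].
- by rewrite linear0 !rmorph0.
- by rewrite linearP !counitP IHx IHy.
rewrite fE (iota_counit HO0) (iota_counit HO1) (ev_counit HA0) (ev_counit HA1).
by rewrite fAE (Gamma_map1 HG1 thhE).
Qed.

Lemma Oq_iso_deformation : is_2cocycle_deformation O1 O0.
Proof.
have [s sE] := torus_form_biscalar T0l T0r bichar.
have [t tE] := torus_form_biscalar T0l T0r bicharV.
have bichar0r u : bichar u 0 = 1 by rewrite /bichar twist_exp0r lq0 rmorph1.
have bichar0l u : bichar 0 u = 1 by rewrite /bichar twist_exp0l lq0 rmorph1.
have bicharV0r u : bicharV u 0 = 1 by rewrite /bicharV twist_exp0r oppr0 lq0
  rmorph1.
exists s, t, f; split; [|split|split].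
- move=> a b; split.
    rewrite -(torus_form_conv T0l T0r T0s bichar_mulV).
    by apply: eq_bigr => x _; apply: eq_bigr => y _; rewrite sE tE.
  have bicharV_mul u v : bicharV u v * bichar u v = 1.
    by rewrite mulrC bichar_mulV.
  rewrite -(torus_form_conv T0l T0r T0s bicharV_mul).
  by apply: eq_bigr => x _; apply: eq_bigr => y _; rewrite sE tE.
- move=> a b c.
  have bicharDl u v x : bichar (u + v) x = bichar u x * bichar v x.
    by rewrite /bichar twist_expDl lqD rmorphM.
  have bicharDr u v x : bichar u (v + x) = bichar u v * bichar u x.
    by rewrite /bichar twist_expDr lqD rmorphM.
  have := torus_form_cocycle T0l T0r T0M T0s bicharDl bicharDr a b c.
  under eq_bigr do under eq_bigr do rewrite -!sE.
  by move=> ->; apply: eq_bigr => x _; apply: eq_bigr => y _; rewrite !sE.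
- by move=> a; rewrite !sE; exact: (torus_form_normalized T0l T0r T01 T0s
  bichar0r bichar0l a).
- exact: Oq_iso_bij.
- (* f 1 is a left unit for the deformed product and 1 is a right unit. *)
  have m1 := cocycle_mul_one T01 T0s sE tE bichar0r bicharV0r.
  rewrite -[f 1]m1.
  have [e eE] : exists e, f e = 1.
    by have [j' _ jf] := Oq_iso_bij; exists (j' 1); rewrite jf.
  by rewrite -eE -(Oq_iso_mul sE tE) mul1r.
- exact: Oq_iso_mul sE tE.
- exact: Oq_iso_cop.
- exact: Oq_iso_counit.
Qed.
End Main.

Lemma twisted_Oq_deformation (C : cartan_datum) (tw : twisting C)
    (k : comNzRingType) (sp : {rmorphism laurent -> k}) (Otw O : hopf k) :
  is_Oq_at tw sp Otw -> is_Oq_at (no_twist C) sp O ->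
  is_2cocycle_deformation Otw O.
Proof.
move=> [U1 [E1 [F1 [K1 [G1 [incl1 [A1 [ev1 [iota1 [HU1 HG1 HA1 HO1]]]]]]]]]].
move=> [U0 [E0 [F0 [K0 [G0 [incl0 [A0 [ev0 [iota0 [HU0 HG0 HA0 HO0]]]]]]]]]].
have [g [h [gP hP gK hK]]] := Uq_iso HU1 HU0.
have [thg thgE] := Gamma_map gP HG1 HG0.
have [thh thhE] := Gamma_map hP HG0 HG1.
have [fA fAE] := Rq_pull hP HG1 thhE HA0 HA1.
have [fA' fAE'] := Rq_pull gP HG0 thgE HA1 HA0.
have [f fE] := base_change_map fA HO1 HO0.
have [f' fE'] := base_change_map fA' HO0 HO1.
exact: (Oq_iso_deformation HU1 HG1 HA1 HO1 HU0 HG0 HA0 HO0 gP hP gK hK thgE thhE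
  fAE fAE' fE fE').
Qed.

Unset Implicit Arguments.

Theorem lemma2p14 (C : cartan_datum) (tw : twisting C)
    (ell : nat) (ell_odd : odd ell) (ell_G2 : type_G2 C -> ~~ (3 %| ell)%N)
    (Qeps : fieldExtType rat) (eps : Qeps)
    (eps_prim : ell.-primitive_root eps)
    (eps_gen : <<1; eps>>%VS = fullv)
    (sp : {rmorphism laurent -> Qeps}) (sp_q : sp ql = eps)
    (Otw O : hopf Qeps) :
  is_Oq_at tw sp Otw ->
  is_Oq_at (no_twist C) sp O ->
  is_2cocycle_deformation Otw O.
Proof.
exact: twisted_Oq_deformation.
Qed.
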